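(* Let $(M,g)$ be a connected Riemannian manifold and let $\boldsymbol{u}$ be a non-trivial concircular vector field on $(M,g)$ with potential function $f$. Then there exists a unique smooth function $\rho : M\to\mathbb{R}$ satisfying $\nabla f=\rho\,\boldsymbol{u}$, where $\nabla f$ is the gradient of $f$.
   Context: A smooth vector field $\boldsymbol{u}$ on a Riemannian manifold $(M,g)$ is called concircular if there is a smooth function $f:M\to\mathbb{R}$ such that $\nabla_X\boldsymbol{u}=fX$ for every smooth vector field $X$ on $M$, where $\nabla$ is the Levi-Civita connection of $g$. The function $f$ is called the potential function of $\boldsymbol{u}$. The concircular vector field is called non-trivial if $f\neq 0$, i.e. $f$ is not identically zero.
   Formalization: The manifold is assumed to have dimension at least 2; in dimension 1 the claim fails (on the flat line, u = (x + x²) d/dx has f = 1 + 2x, whose gradient is nonzero at x = 0 where u vanishes), and in dimension 0 uniqueness fails. *)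

(* Defs.v *)
From HB Require Import structures.
From mathcomp Require Import all_boot all_order all_algebra.
From mathcomp Require Import all_classical all_reals all_analysis.

Set Implicit Arguments.
Unset Strict Implicit.
Unset Printing Implicit Defensive.
Import Order.TTheory GRing.Theory Num.Theory.
Import numFieldNormedType.Exports.

Local Open Scope classical_set_scope.
Local Open Scope ring_scope.

(* Class C^k by iterated partial derivatives.  It is only meant for O open,
   where it depends only on the restriction of F to O. *)
Fixpoint Ck (R : realType) (n : nat) (V : normedModType R) (k : nat)
    (O : set 'rV[R]_n) (F : 'rV[R]_n -> V) : Prop :=
  (forall x, O x -> {for x, continuous F}) /\
  if k is k'.+1 then
    forall i : 'I_n,
      (forall x, O x -> derivable F x (delta_mx 0 i)) /\
      Ck k' O (fun x => 'D_(delta_mx 0 i) F x)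
  else True.

Definition smooth_on (R : realType) (n : nat) (V : normedModType R)
    (O : set 'rV[R]_n) (F : 'rV[R]_n -> V) : Prop :=
  forall k, Ck k O F.

(* A chart is a homeomorphism from the open set [chart_dom] onto the open
   subset [chart_cod] of R^n; both maps are total, with irrelevant values
   outside of these sets. *)
Record chart (R : realType) (M : topologicalType) (n : nat) := Chart {
  chart_dom : set M ;
  chart_cod : set 'rV[R]_n ;
  chart_map : M -> 'rV[R]_n ;
  chart_inv : 'rV[R]_n -> M ;
  chart_dom_open : open chart_dom ;
  chart_cod_open : open chart_cod ;
  chart_map_cod : forall p, chart_dom p -> chart_cod (chart_map p) ;
  chart_inv_dom : forall x, chart_cod x -> chart_dom (chart_inv x) ;
  chart_mapK : forall p, chart_dom p -> chart_inv (chart_map p) = p ;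
  chart_invK : forall x, chart_cod x -> chart_map (chart_inv x) = x ;
  chart_map_continuous :
    forall p, chart_dom p -> {for p, continuous chart_map} ;
  chart_inv_continuous :
    forall x, chart_cod x -> {for x, continuous chart_inv} }.

(* The atlas need not be maximal. *)
Record manifold (R : realType) (n : nat) := Manifold {
  mcarrier :> topologicalType ;
  manifold_hausdorff : hausdorff_space mcarrier ;
  manifold_second_countable : @second_countable mcarrier ;
  atlas : set (chart R mcarrier n) ;
  atlas_cover : forall p : mcarrier, exists2 c, atlas c & chart_dom c p ;
  atlas_compatible : forall c c', atlas c -> atlas c' ->
    smooth_on (chart_cod c `&` chart_inv c @^-1` chart_dom c')
              (chart_map c' \o chart_inv c) }.

Section Manifold.
Variables (R : realType) (n : nat) (M : manifold R n).

Definition smooth (f : M -> R) : Prop :=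
  forall c, atlas c -> smooth_on (chart_cod c) (f \o chart_inv c).

(* Tangent vectors at p are the derivations at p of the algebra of smooth
   functions.  They are represented by functionals on all functions M -> R,
   set to 0 on the functions which are not smooth, so that two tangent vectors
   are equal as soon as they agree on smooth functions. *)
Definition functional : Type := (M -> R) -> R.

HB.instance Definition _ := GRing.Lmodule.on functional.

Definition tangent (p : M) : set functional := [set v |
  [/\ forall (a : R) f h, smooth f -> smooth h ->
        v (fun q => a * f q + h q) = a * v f + v h,
      forall f h, smooth f -> smooth h ->
        v (fun q => f q * h q) = f p * v h + h p * v f &
      forall f, ~ smooth f -> v f = 0]].

Definition field : Type := M -> functional.

HB.instance Definition _ := GRing.Zmodule.on field.

Definition field_app (X : field) (f : M -> R) : M -> R := fun p => X p f.

Definition field_scale (h : M -> R) (X : field) : field :=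
  fun p => h p *: X p.

Definition smooth_field (X : field) : Prop :=
  (forall p, tangent p (X p)) /\
  (forall f, smooth f -> smooth (field_app X f)).

Definition lie_bracket (X Y : field) : field :=
  fun p f => X p (field_app Y f) - Y p (field_app X f).

(* Only the values g p v w with v and w tangent at p are relevant. *)
Definition riemannian_metric (g : M -> functional -> functional -> R) : Prop :=
  [/\ forall p (a : R) v v' w, tangent p v -> tangent p v' -> tangent p w ->
        g p (a *: v + v') w = a * g p v w + g p v' w,
      forall p v w, tangent p v -> tangent p w -> g p v w = g p w v,
      forall p v, tangent p v -> v <> 0 -> 0 < g p v v &
      forall X Y, smooth_field X -> smooth_field Y ->
        smooth (fun p => g p (X p) (Y p))].

Definition affine_connection (nabla : field -> field -> field) : Prop :=
  [/\ forall X Y, smooth_field X -> smooth_field Y -> smooth_field (nabla X Y),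
      forall h X X' Y, smooth h ->
        smooth_field X -> smooth_field X' -> smooth_field Y ->
        nabla (field_scale h X + X') Y
          = field_scale h (nabla X Y) + nabla X' Y,
      forall X Y Y', smooth_field X -> smooth_field Y -> smooth_field Y' ->
        nabla X (Y + Y') = nabla X Y + nabla X Y' &
      forall h X Y, smooth h -> smooth_field X -> smooth_field Y ->
        nabla X (field_scale h Y)
          = field_scale h (nabla X Y) + field_scale (field_app X h) Y].

Definition torsion_free (nabla : field -> field -> field) : Prop :=
  forall X Y, smooth_field X -> smooth_field Y ->
    nabla X Y - nabla Y X = lie_bracket X Y.

Definition metric_compatible (g : M -> functional -> functional -> R)
    (nabla : field -> field -> field) : Prop :=
  forall X Y Z, smooth_field X -> smooth_field Y -> smooth_field Z ->
    field_app X (fun p => g p (Y p) (Z p))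
      = (fun p => g p (nabla X Y p) (Z p) + g p (Y p) (nabla X Z p)).

Definition levi_civita (g : M -> functional -> functional -> R)
    (nabla : field -> field -> field) : Prop :=
  [/\ affine_connection nabla, torsion_free nabla & metric_compatible g nabla].

Definition concircular (nabla : field -> field -> field) (u : field)
    (f : M -> R) : Prop :=
  [/\ smooth_field u, smooth f &
      forall X, smooth_field X -> nabla X u = field_scale f X].

(* The unique tangent vector at p which represents the differential of f. *)
Definition gradient (g : M -> functional -> functional -> R) (f : M -> R) :
    field :=
  fun p => xget 0
    [set v | tangent p v /\ forall w, tangent p w -> g p v w = w f].

End Manifold.

(* Main.v *)
From HB Require Import structures.
Require Import Defs.
From mathcomp Require Import all_boot all_order all_algebra.
From mathcomp Require Import all_classical all_reals all_analysis.
From mathcomp Require Import ring lra.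
Import Order.TTheory GRing.Theory Num.Theory.
Import numFieldNormedType.Exports.
Local Open Scope classical_set_scope.
Local Open Scope ring_scope.

(** Write N = g(u,u), and let al(X) = g(X,u) be the 1-form dual to u.  Since
    nabla_X u = f X, the metric gives X(N) = 2 f al(X); applying the bracket
    of two fields to N shows that df and al are parallel, X(f) al(Y) = Y(f) al(X)
    ([differential_parallel]).  Where u does not vanish, Y = u yields
    df = (u(f) / N) al, so that rho has to be u(f) / N there.  It remains to see
    that this ratio extends smoothly through the zeros of u.

    The zeros are tame.  Differentiating al(W) twice gives a curvature identity
    X(f) g(Y,W) - Y(f) g(X,W) = g(Q,u) + f K in which Q and K are smooth
    ([curvature_identity]).  In dimension at least 2 one may choose W = Y
    orthogonal to X, which bounds X(f) by a multiple of |u| + |f|.  Hence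
    H = N + f^2 satisfies |dH| <= C H locally, and by Gronwall the zero set of H
    is open ([common_zero_near]); it is also closed, M is connected and f is not
    identically zero, so u and f have no common zero ([no_common_zero]).
    If u vanished near a point, then so would X(al(X)) = f g(X,X), hence f:
    thus N is nonzero on a dense set ([zeros_nowhere_dense]), which makes rho
    unique and lets every identity be checked where N is nonzero.

    At a zero p of u, the components al_i = al(X_i) in a frame have the
    invertible Jacobian matrix f(p) g(X_i,X_j).  In a chart centered at p,
    Hadamard's lemma writes al = A(y) y with A smooth and A(0) invertible, and
    the components V_i = X_i(f) satisfy V = rho al = rho A y away from 0.  So
    adj(A) V = rho det(A) y, whose first component vanishes on the hyperplane
    y_1 = 0; a second use of Hadamard's lemma, in the variable y_1 alone,
    divides it by y_1, and rho det(A) is smooth ([radial_division]).  This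
    avoids the inverse function theorem.

    The rest is the calculus that these arguments need: C^k functions are closed
    under products, quotients and composition, integrals over a segment depend
    smoothly on a parameter, and bump functions turn local coordinates into
    global smooth functions and fields. *)

Set Implicit Arguments.
Unset Strict Implicit.
Unset Printing Implicit Defensive.

Local Notation e_ i := (delta_mx 0 i).

(** * Calculus of functions of class C^k *)

Section CkAlgebra.
Context (R : realType) (n : nat).
Implicit Types (O U : set 'rV[R]_n) (F G : 'rV[R]_n -> R) (k : nat).

Lemma open_near O x : open O -> O x -> \forall y \near x, O y.
Proof. by move=> oO Ox; apply: open_nbhs_nbhs. Qed.

Lemma Ck_continuous k O F x : Ck k O F -> O x -> {for x, continuous F}.
Proof. by case: k => [|k] [h _]; apply: h. Qed.

Lemma CkS k O F : Ck k.+1 O F -> Ck k O F.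
Proof.
elim: k F => [|k IH] F [cF dF]; first by [].
by split=> // i; have [h1 h2] := dF i; split=> //; apply: IH.
Qed.

Lemma Ck_le k l O F : (k <= l)%N -> Ck l O F -> Ck k O F.
Proof.
move=> /subnK <-; elim: (l - k)%N => [//|m IH].
by rewrite addSn => /CkS.
Qed.

Lemma Ck_sub k O U F : U `<=` O -> Ck k O F -> Ck k U F.
Proof.
move=> UO; elim: k F => [|k IH] F [cF dF]; split=> //; try by move=> x /UO/cF.
by move=> i; have [h1 h2] := dF i; split; [move=> x /UO/h1|apply: IH].
Qed.

Lemma Ck_local k O F :
  (forall x, O x -> exists2 U, U x & Ck k U F) -> Ck k O F.
Proof.
elim: k F => [|k IH] F h.
  by split=> // x /h[U Ux /Ck_continuous]; apply.
split; first by move=> x /h[U Ux /Ck_continuous]; apply.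
move=> i; split; first by move=> x /h[U Ux [_ /(_ i)[+ _]]]; apply.
by apply: IH => x /h[U Ux [_ /(_ i)[_ ?]]]; exists U.
Qed.

Lemma Ck_ext k O F G : open O -> {in O, F =1 G} -> Ck k O F -> Ck k O G.
Proof.
move=> oO; have near_eq H K : {in O, H =1 K} ->
    forall x, O x -> \forall y \near x, H y = K y.
  by move=> e x Ox; near do (apply: e; apply/mem_set); apply: open_near.
elim: k F G => [|k IH] F G FG [cF dF].
  split=> // x Ox; have h := near_eq _ _ _ FG x Ox.
  rewrite /prop_for /continuous_at -(nbhs_singleton h).
  exact: cvg_trans (near_eq_cvg h) (cF x Ox).
split=> [x Ox|i].
  have h := near_eq _ _ _ FG x Ox.
  rewrite /prop_for /continuous_at -(nbhs_singleton h).
  exact: cvg_trans (near_eq_cvg h) (cF x Ox).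
have [h1 h2] := dF i; split=> [x Ox|].
  exact: near_eq_derivable (near_eq _ _ _ FG x Ox) (h1 x Ox).
apply: IH h2 => x /set_mem Ox; apply: near_eq_derive; exact: near_eq.
Unshelve. all: by end_near. Qed.

Lemma Ck_cst k O (c : R) : open O -> Ck k O (cst c).
Proof.
move=> oO; elim: k c => [|k IH] c; split=> //; try by move=> x _; apply: cst_continuous.
move=> i; split=> [x _|]; first exact: derivable_cst.
apply: (@Ck_ext _ _ (cst 0)) => //; first by move=> x _; rewrite derive_cst.
Qed.

Lemma Ck_add k O F G : open O -> Ck k O F -> Ck k O G ->
  Ck k O (fun x => F x + G x).
Proof.
move=> oO; elim: k F G => [|k IH] F G [cF dF] [cG dG].
  by split=> // x Ox; apply: continuousD; [apply: cF|apply: cG].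
split=> [x Ox|i]; first by apply: continuousD; [apply: cF|apply: cG].
have [dF1 dF2] := dF i; have [dG1 dG2] := dG i; split=> [x Ox|].
  by apply: derivableD; [apply: dF1|apply: dG1].
apply: (Ck_ext oO _ (IH _ _ dF2 dG2)) => x /set_mem Ox.
by rewrite [RHS]deriveD; [|apply: dF1|apply: dG1].
Qed.

Lemma Ck_mul k O F G : open O -> Ck k O F -> Ck k O G ->
  Ck k O (fun x => F x * G x).
Proof.
move=> oO; elim: k F G => [|k IH] F G cF cG.
  by split=> // x Ox; apply: continuousM; [case: cF|case: cG] => + _; apply.
have [cF' dF] := cF; have [cG' dG] := cG.
split=> [x Ox|i]; first by apply: continuousM; [apply: cF'|apply: cG'].
have [dF1 dF2] := dF i; have [dG1 dG2] := dG i; split=> [x Ox|].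
  by apply: derivableM; [apply: dF1|apply: dG1].
have := Ck_add oO (IH _ _ (CkS cF) dG2) (IH _ _ (CkS cG) dF2).
apply: (Ck_ext oO) => x /set_mem Ox.
by rewrite [RHS]deriveM; [|apply: dF1|apply: dG1].
Qed.

Lemma Ck_sum k O (I : Type) (r : seq I) (P : pred I) (F : I -> 'rV[R]_n -> R) :
  open O -> (forall i, P i -> Ck k O (F i)) -> Ck k O (fun x => \sum_(i <- r | P i) F i x).
Proof.
move=> oO h; elim: r => [|i r IH].
  by apply: (@Ck_ext _ _ (cst 0)) => //; [move=> x _; rewrite big_nil|exact: Ck_cst].
case Pi: (P i).
  apply: (@Ck_ext _ _ (fun x => F i x + \sum_(j <- r | P j) F j x)) => //.
    by move=> x _; rewrite big_cons Pi.
  by apply: Ck_add => //; apply: h.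
by apply: (Ck_ext oO _ IH) => x _; rewrite big_cons Pi.
Qed.

Lemma Ck_prod k O (I : Type) (r : seq I) (P : pred I) (F : I -> 'rV[R]_n -> R) :
  open O -> (forall i, P i -> Ck k O (F i)) -> Ck k O (fun x => \prod_(i <- r | P i) F i x).
Proof.
move=> oO h; elim: r => [|i r IH].
  by apply: (@Ck_ext _ _ (cst 1)) => //; [move=> x _; rewrite big_nil|exact: Ck_cst].
case Pi: (P i).
  apply: (@Ck_ext _ _ (fun x => F i x * \prod_(j <- r | P j) F j x)) => //.
    by move=> x _; rewrite big_cons Pi.
  by apply: Ck_mul => //; apply: h.
by apply: (Ck_ext oO _ IH) => x _; rewrite big_cons Pi.
Qed.

Lemma Ck_inv k O F : open O -> (forall x, O x -> F x != 0) -> Ck k O F ->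
  Ck k O (fun x => (F x)^-1).
Proof.
move=> oO F0; elim: k => [|k IH] cF.
  by split=> // x Ox; apply: continuousV; [apply: F0|case: cF => + _; apply].
have [cF' dF] := cF.
split=> [x Ox|i]; first by apply: continuousV; [apply: F0|apply: cF'].
have [dF1 dF2] := dF i; split=> [x Ox|].
  by apply: derivableV; [apply: F0|apply: dF1].
have C := IH (CkS cF).
have := Ck_mul oO (Ck_cst k (-1) oO) (Ck_mul oO (Ck_mul oO C C) dF2).
apply: (Ck_ext oO) => x /set_mem Ox.
rewrite [RHS]deriveV; [|apply: F0|apply: dF1] => //.
by rewrite /cst mulN1r expr2 invfM scaleNr.
Qed.

Lemma is_derive_coord (i : 'I_n) (x v : 'rV[R]_n) :
  is_derive x v (fun y : 'rV[R]_n => y 0 i) (v 0 i).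
Proof.
have d : derivable (id : 'rV[R]_n -> 'rV[R]_n) x v by exact: derivable_id.
split; first exact: (derivable_mxP _ _ _).1.
by have /matrixP/(_ 0 i) := derive_mx d; rewrite derive_id mxE => ->.
Qed.

Lemma Ck_coord k O (i : 'I_n) : open O -> Ck k O (fun y => y 0 i).
Proof.
move=> oO; case: k => [|k]; split=> //; try by move=> x _; exact: coord_continuous.
move=> j; split=> [x _|]; first by have [] := is_derive_coord i x (e_ j).
apply: (@Ck_ext _ _ (cst ((e_ j : 'rV[R]_n) 0 i))) => //; last exact: Ck_cst.
by move=> x _; have [_ ->] := is_derive_coord i x (e_ j).
Qed.

End CkAlgebra.

(** * Mean values, differentiability and the chain rule *)

Section MeanValue.
Context (R : realType) (n : nat).
Implicit Types (F : 'rV[R]_n -> R) (x y c v : 'rV[R]_n).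

Lemma rV_ballP c r x : ball c r x <-> 0 < r /\ forall j, `|c 0 j - x 0 j| < r.
Proof.
split=> [[r0 h]|[r0 h]]; first by split=> // j; exact: (h 0 j).
by split=> // i j; rewrite ord1; exact: h.
Qed.

(** Reduces derivatives along v to derivatives of functions of one variable. *)
Lemma is_derive_line F y v (s d : R) :
  is_derive (y + s *: v) v F d -> is_derive s 1 (fun t => F (y + t *: v)) d.
Proof.
move=> [dF <-].
have e : (fun h : R => h^-1 *: (((fun t => F (y + t *: v)) \o shift s) (h *: 1)
            - F (y + s *: v)))
    = (fun h => h^-1 *: ((F \o shift (y + s *: v)) (h *: v) - F (y + s *: v))).
  by apply/funext => h /=; rewrite [h *: 1]mulr1 addrCA -scalerDl.
by split; rewrite /derivable /derive e.
Qed.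

Lemma mvt_pos F y (i : 'I_n) t : 0 < t ->
  (forall s, 0 <= s <= t -> derivable F (y + s *: e_ i) (e_ i)) ->
  exists2 s, 0 <= s <= t &
    F (y + t *: e_ i) - F y = t * 'D_(e_ i) F (y + s *: e_ i).
Proof.
move=> t0 dF.
have D s : 0 <= s <= t -> is_derive s 1 (fun s => F (y + s *: e_ i))
    ('D_(e_ i) F (y + s *: e_ i)).
  by move=> st; apply: is_derive_line; apply: derivableP; apply: dF.
have [| |s st] := @MVT R (fun s => F (y + s *: e_ i))
  (fun s => 'D_(e_ i) F (y + s *: e_ i)) 0 t t0.
- move=> s; rewrite in_itv/= => /andP[a b]; apply: D.
  by rewrite !ltW.
- apply: derivable_within_continuous => s; rewrite in_itv/= => /D[]//.
rewrite scale0r addr0 subr0 mulrC => ->; exists s => //.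
by move: st; rewrite in_itv/= => /andP[a b]; rewrite !ltW.
Qed.

Lemma mvt_coord F y (i : 'I_n) t :
  (forall s, Num.min 0 t <= s <= Num.max 0 t -> derivable F (y + s *: e_ i) (e_ i)) ->
  exists2 s, Num.min 0 t <= s <= Num.max 0 t &
    F (y + t *: e_ i) - F y = t * 'D_(e_ i) F (y + s *: e_ i).
Proof.
case: (ltgtP t 0) => [t0|t0|->] h.
- have [||s /andP[s0 st]] := @mvt_pos F (y + t *: e_ i) i (- t).
  + by rewrite oppr_gt0.
  + move=> s /andP[s0 st]; rewrite -addrA -scalerDl; apply: h; apply/andP; split; lra.
  rewrite -!addrA -!scalerDl subrr scale0r addr0 mulNr => /(congr1 -%R).
  rewrite opprB opprK => ->; exists (t + s) => //; apply/andP; split; lra.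
- exact: mvt_pos.
- by exists 0; [lra|rewrite scale0r addr0 subrr mul0r].
Qed.

(** The balls of row vectors are cubes, so that one can move from x to y one
    coordinate at a time without leaving the ball; each move is an instance of
    the mean value theorem in one variable. *)
Lemma mvt_ball c r F x y : (forall z, ball c r z -> forall i, derivable F z (e_ i)) ->
  ball c r x -> ball c r y ->
  exists2 xi : 'I_n -> 'rV[R]_n, forall i, ball c r (xi i) &
    F y - F x = \sum_i (y 0 i - x 0 i) * 'D_(e_ i) F (xi i).
Proof.
move=> dF /rV_ballP[r0 bx] /rV_ballP[_ b_y].
pose z k : 'rV[R]_n := \row_j (if (j < k)%N then y 0 j else x 0 j).
(* [z k] has the first k coordinates of y and the other ones of x. *)
have zS (i : 'I_n) : z i.+1 = z i + (y 0 i - x 0 i) *: e_ i.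
  apply/rowP => j; rewrite !mxE eqxx/= ltnS -val_eqE /=.
  case: ltngtP => ji /=; rewrite ?mulr0 ?addr0 ?mulr1 //.
  by rewrite (val_inj ji) addrC subrK.
have bz (i : 'I_n) s : Num.min 0 (y 0 i - x 0 i) <= s <= Num.max 0 (y 0 i - x 0 i) ->
    ball c r (z i + s *: e_ i).
  move=> st; apply/rV_ballP; split=> // j; rewrite !mxE eqxx/=.
  have := bx j; have := b_y j.
  have [->|ji] := eqVneq j i; last by rewrite mulr0 addr0; case: ifP.
  rewrite ltnn mulr1 !ltr_norml => /andP[a1 a2] /andP[a3 a4].
  move: st; case: (ltgtP 0 (y 0 i - x 0 i)) => h /andP[s1 s2];
    by apply/andP; split; lra.
have H (i : 'I_n) : exists xi, ball c r xi /\
   F (z i.+1) - F (z i) = (y 0 i - x 0 i) * 'D_(e_ i) F xi.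
  have [|s st] := @mvt_coord F (z i) i (y 0 i - x 0 i).
    by move=> s st; apply: dF; apply: bz.
  by rewrite -zS => ->; exists (z i + s *: e_ i); split=> //; apply: bz.
have [xi Hxi] := choice H.
exists xi; first by move=> i; have [] := Hxi i.
have -> : F y - F x = F (z n) - F (z 0%N).
  by congr (F _ - F _); apply/rowP => j; rewrite !mxE ?ltn_ord.
rewrite -(telescope_sumr (fun k => F (z k)) (leq0n n)) big_mkord.
by apply: eq_bigr => i _; have [] := Hxi i.
Qed.

Lemma rV_norm_coord (h : 'rV[R]_n) i : `|h 0 i| <= `|h|.
Proof.
rewrite [leRHS]/Num.Def.normr/= mx_normrE.
exact: (le_bigmax _ (fun ij : 'I_1 * 'I_n => `|h ij.1 ij.2|) (0, i)).
Qed.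

End MeanValue.

Lemma is_derive_line0 (R : realType) (n : nat) (F : 'rV[R]_n -> R)
    (x v : 'rV[R]_n) (d : R) :
  is_derive (0 : R) (1 : R) (fun t : R => F (x + t *: v)) d -> is_derive x v F d.
Proof.
move=> [dF <-].
have e : (fun h : R => h^-1 *: (((fun t => F (x + t *: v)) \o shift 0) (h *: 1)
            - F (x + 0 *: v)))
    = (fun h => h^-1 *: ((F \o shift x) (h *: v) - F x)).
  by apply/funext => h /=; rewrite [h *: 1]mulr1 addr0 scale0r addr0 [x + _]addrC.
by split; rewrite /derivable /derive -e.
Qed.

Section C1Differentiable.
Context (R : realType) (n : nat).
Implicit Types (F : 'rV[R]_n -> R) (x v : 'rV[R]_n).

(** Continuous partial derivatives give Frechet differentiability: by
    [mvt_ball] on a small ball around x, F (x + h) - F x is a combination of the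
    h_i whose coefficients are close to the partial derivatives at x. *)
Lemma C1_differentiable (O : set 'rV[R]_n) F x : open O -> O x -> Ck 1 O F ->
  differentiable F x /\
  forall v, 'D_v F x = \sum_i v 0 i * 'D_(e_ i) F x.
Proof.
move=> oO Ox [_ dF].
pose g v : R := \sum_i v 0 i * 'D_(e_ i) F x.
have lg : linear g.
  move=> a u v; rewrite /g scaler_sumr -big_split; apply: eq_bigr => i _ /=.
  by rewrite !mxE mulrDl /GRing.scale/= mulrA.
pose L : {linear 'rV[R]_n -> R} := HB.pack g (GRing.isLinear.Build _ _ _ _ _ lg).
have cL : continuous L.
  have [cg _] : Ck 0 setT g.
    apply: Ck_sum => [|i _]; first exact: openT.
    by apply: Ck_mul; [exact: openT|apply: Ck_coord|apply: Ck_cst]; exact: openT.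
  by move=> v; exact: cg.
have small eps : 0 < eps -> \forall h \near (0 : 'rV[R]_n),
    `|F (h + x) - (F x + g h)| <= eps * `|h|.
  move=> eps0.
  pose e1 := eps / n.+1%:R.
  have e10 : 0 < e1 by rewrite divr_gt0.
  have : \forall z \near x, O z /\ forall i : 'I_n, `|'D_(e_ i) F z - 'D_(e_ i) F x| < e1.
    apply: filterI; first exact: open_near.
    have near_i (i : 'I_n) : \forall z \near x, `|'D_(e_ i) F z - 'D_(e_ i) F x| < e1.
      have [_ [c _]] := dF i.
      have /cvgrPdist_lt/(_ _ e10) := c x Ox.
      by apply: filterS => z; rewrite distrC.
    exact: filter_forall near_i.
  move=> /nbhs_ballP[r /= r0 hr].
  near=> h.
  have bh : ball x r (h + x).
    rewrite -ball_normE /ball_/= opprD addrA addrAC subrr sub0r normrN.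
    near: h; apply/nbhs_ballP; exists r => //= h.
    by rewrite -ball_normE /ball_/= sub0r normrN.
  have [z bz|xi bxi E] := @mvt_ball R n x r F x (h + x) _ (ballxx _ r0) bh.
    by move=> i; have [d _] := dF i; apply: d; have [] := hr z bz.
  rewrite opprD addrA E /g -sumrB.
  have -> : eps * `|h| = e1 * `|h| *+ n.+1.
    by rewrite /e1 -mulr_natl mulrA mulrCA mulfV ?mulr1 ?pnatr_eq0.
  apply: (@le_trans _ _ (e1 * `|h| *+ n)); last first.
    by rewrite mulrSr lerDl mulr_ge0 // ltW.
  apply: le_trans (ler_norm_sum _ _ _) _.
  rewrite -[X in _ <= _ *+ X]card_ord -sumr_const; apply: ler_sum => i _.
  rewrite !mxE addrK -mulrBr normrM mulrC.
  apply: ler_pM => //; last exact: rV_norm_coord.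
  by apply: ltW; have [_] := hr _ (bxi i); apply.
have dE : 'd F x = L :> ('rV[R]_n -> R).
  by apply: diff_unique => //; apply/eqaddoP => eps /small.
have D : differentiable F x.
  apply/diff_locallyP; rewrite dE; split=> //.
  by apply/eqaddoP => eps /small.
split=> // v; rewrite deriveE // dE //.
Unshelve. all: by end_near. Qed.

Lemma is_derive_comp_line (G : R -> 'rV[R]_n) F (O : set 'rV[R]_n) (s : R)
    (d : 'rV[R]_n) :
  open O -> O (G s) -> Ck 1 O F -> is_derive s (1 : R) G d ->
  is_derive s (1 : R) (F \o G) (\sum_j d 0 j * 'D_(e_ j) F (G s)).
Proof.
move=> oO OG cF [dG <-].
have [DF EF] := C1_differentiable oO OG cF.
have DG : differentiable G s by exact/derivable1_diffP.
have D : differentiable (F \o G) s by exact: differentiable_comp.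
split; first exact/derivable1_diffP.
rewrite deriveE // diff_comp //= -EF deriveE // deriveE //.
Qed.

End C1Differentiable.

Lemma continuous_row (R : realType) (T : topologicalType) (m : nat)
    (G : T -> 'rV[R]_m) (x : T) :
  (forall j, {for x, continuous (fun y => G y 0 j)}) -> {for x, continuous G}.
Proof.
move=> cG; apply/cvgrPdist_lt => e e0.
have near_j (j : 'I_m) : \forall y \near x, `|G x 0 j - G y 0 j| < e.
  by have /cvgrPdist_lt/(_ _ e0) := cG j.
apply: (@filterS _ (nbhs x) _ _ _ _ (filter_forall _ near_j)) => y hy.
suff: ball (G x) e (G y) by rewrite -ball_normE.
by apply/rV_ballP.
Qed.

Section Composition.
Context (R : realType) (n m : nat).

(** The chain rule expresses the partial derivatives of F \o G by sums of
    products of functions of class C^(k-1), one of which is again a composition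
    with G: hence the induction on k for all F at once. *)
Lemma Ck_comp k (O : set 'rV[R]_n) (U : set 'rV[R]_m) (F : 'rV[R]_m -> R)
    (G : 'rV[R]_n -> 'rV[R]_m) :
  open O -> open U -> (forall x, O x -> U (G x)) ->
  (forall j, Ck k O (fun x => G x 0 j)) -> Ck k U F -> Ck k O (F \o G).
Proof.
move=> oO oU OU; elim: k F => [|k IH] F cG cF.
  split=> // x Ox.
  have cGx : {for x, continuous G}.
    by apply: continuous_row => j; have [c _] := cG j; exact: c.
  apply: continuous_comp; first exact: cGx.
  by case: cF => + _; apply; apply: OU.
have cF1 : Ck 1 U F by apply: Ck_le cF.
have dcomp x (i : 'I_n) : O x -> is_derive x (e_ i) (F \o G)
   (\sum_j 'D_(e_ i) (fun x => G x 0 j) x * 'D_(e_ j) F (G x)).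
  move=> Ox; apply: is_derive_line0.
  have dG : is_derive (0 : R) (1 : R) (fun t : R => G (x + t *: e_ i))
     (\row_j 'D_(e_ i) (fun x => G x 0 j) x).
    have dj j : is_derive (0 : R) (1 : R) (fun t : R => G (x + t *: e_ i) 0 j)
        ('D_(e_ i) (fun x => G x 0 j) x).
      have := @is_derive_line R n (fun x => G x 0 j) x (e_ i) 0.
      rewrite scale0r addr0; apply; apply: derivableP.
      by have [_ /(_ i)[d _]] := cG j; apply: d.
    have D : derivable (fun t : R => G (x + t *: e_ i)) 0 1.
      by apply/derivable_mxP => a j; rewrite ord1; have [] := dj j.
    split=> //; rewrite derive_mx //; apply/matrixP => a j.
    by rewrite !mxE ord1; have [_ ->] := dj j.
  have := is_derive_comp_line (s := 0) oU _ cF1 dG.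
  rewrite scale0r addr0 => /(_ (OU _ Ox)).
  by under eq_bigr do rewrite mxE.
split=> [x Ox|i].
  apply: (Ck_continuous (k := k) (O := O)) => //; apply: IH (CkS cF) => j.
  exact: CkS.
split=> [x Ox|]; first by have [] := dcomp x i Ox.
have: Ck k O (fun x => \sum_j 'D_(e_ i) (fun x => G x 0 j) x * ('D_(e_ j) F \o G) x).
  apply: Ck_sum => // j _; apply: Ck_mul => //.
    by have [_ /(_ i)[_ d]] := cG j.
  apply: IH; first by move=> l; apply: CkS.
  by have [_ /(_ j)[_ d]] := cF.
apply: Ck_ext => // x /set_mem Ox.
by have [_ <-] := dcomp x i Ox.
Qed.

Lemma Ck_component k (O : set 'rV[R]_n) (G : 'rV[R]_n -> 'rV[R]_m) (j : 'I_m) :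
  open O -> Ck k O G -> Ck k O (fun x => G x 0 j).
Proof.
move=> oO; elim: k G => [|k IH] G [cG dG].
  split=> // x Ox; apply: (@continuous_comp _ _ _ G (fun y => y 0 j)); first exact: cG.
  exact: coord_continuous.
split=> [x Ox|i].
  apply: (@continuous_comp _ _ _ G (fun y => y 0 j)); first exact: cG.
  exact: coord_continuous.
have [d1 d2] := dG i; split=> [x Ox|].
  by have /derivable_mxP/(_ 0 j) := d1 x Ox.
apply: Ck_ext (IH _ d2) => // x /set_mem Ox.
by rewrite derive_mx ?mxE //; exact: d1.
Qed.
End Composition.

(** * Bump functions *)

Section Flat.
Context (R : realType).
Implicit Types (s : R) (m : nat).

(** The family s^(-m) exp(-1/s), extended by 0 to s <= 0: it is closed under
    differentiation up to linear combinations, which is why the exponent m is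
    carried along. *)
Definition flat m s : R := if 0 < s then s^-1 ^+ m * expR (- s^-1) else 0.

Lemma flat_ge0 m s : 0 <= flat m s.
Proof.
rewrite /flat; case: ifP => // s0.
by rewrite mulr_ge0 ?expR_ge0// exprn_ge0// invr_ge0 ltW.
Qed.

Lemma flat_gt0 m s : (0 < flat m s) = (0 < s).
Proof.
rewrite /flat; case: ifP => [s0|]; last by rewrite ltxx.
by rewrite mulr_gt0 ?expR_gt0// exprn_gt0// invr_gt0.
Qed.

(** The quadratic bound at 0 is what makes the derivative at 0 vanish.  It comes
    from exp y >= (y / c)^c with c = m + 2 and y = 1 / s. *)
Lemma flat_le_sqr m s : `|flat m s| <= m.+2%:R ^+ m.+2 * s ^+ 2.
Proof.
rewrite ger0_norm ?flat_ge0 // /flat; case: ifP => [s0|_]; last first.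
  by rewrite mulr_ge0 ?sqr_ge0 ?exprn_ge0.
set y := s^-1; have y0 : 0 < y by rewrite invr_gt0.
have sy : s = y^-1 by rewrite invrK.
pose c : R := m.+2%:R; have c0 : 0 < c by rewrite ltr0n.
have h : (y / c) ^+ m.+2 <= expR y.
  have -> : expR y = expR (y / c) ^+ m.+2.
    rewrite -expRM_natr; congr expR; rewrite -mulrA mulVf ?mulr1 //.
    exact: lt0r_neq0.
  apply: lerXn2r; rewrite ?nnegrE ?expR_ge0 //; first by rewrite divr_ge0 ?ltW.
  by apply: le_trans (expR_ge1Dx _); rewrite lerDr.
have e0 := expR_gt0 y.
rewrite expRN sy [y^-1 ^+ 2]exprVn ler_pdivrMr // mulrAC ler_pdivlMr ?exprn_gt0 //.
rewrite -exprD addn2 -/c; move: h; rewrite expr_div_n ler_pdivrMr ?exprn_gt0 //.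
by rewrite mulrC.
Qed.

Lemma is_derive_flat m s :
  is_derive s (1 : R) (flat m) (- m%:R * flat m.+1 s + flat m.+2 s).
Proof.
have [s0|s0|<-] := ltgtP 0 s.
- pose psi := (fun y : R => y ^+ m * expR (- y)).
  have D : is_derive s (1 : R) (psi \o GRing.inv)
     (- m%:R * flat m.+1 s + flat m.+2 s).
    have s1 : s != 0 by apply: lt0r_neq0.
    have d1 : is_derive s (1:R) (fun x : R => x^-1) (- s^-2).
      split; first exact: (@derivableV _ _ id).
      by rewrite (@deriveV _ _ id) // derive_id [LHS]mulr1.
    have d2 y : is_derive y (1:R) psi ((m%:R * y ^+ m.-1) * expR (- y) - y ^+ m * expR (- y)).
      have dX : is_derive y (1:R) (fun y : R => y ^+ m) (m%:R * y ^+ m.-1).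
        by split; [exact: exprn_derivable|rewrite exp_derive [LHS]mulr1].
      have dE : is_derive y (1:R) (fun y : R => expR (- y)) (- expR (- y)).
        by rewrite -mulrN1; apply: is_derive1_comp.
      have := is_deriveM dX dE; move=> /is_derive_eq; apply.
      rewrite /GRing.scale/=; ring.
    have := @is_derive1_comp _ psi GRing.inv s _ _ (d2 _) d1.
    move=> /is_derive_eq; apply; rewrite /flat s0.
    rewrite -exprVn; move: (s^-1) (expR _) => y e.
    case: (m) => [|l]; first by rewrite expr0; ring.
    by rewrite /= !exprS; ring.
  apply: near_eq_is_derive D.
  have : \forall x \near s, 0 < x by exact: lt_nbhsr.
  by apply: filterS => x x0; rewrite /flat x0.
- have := @is_derive_cst R R R 0 s 1.
  rewrite /flat (lt_gtF s0) mulr0 addr0.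
  apply: near_eq_is_derive.
  have : \forall x \near s, x < 0 by exact: lt_nbhsl.
  by apply: filterS => x x0; rewrite /flat (lt_gtF x0).
- rewrite /flat ltxx mulr0 addr0.
  have c : h^-1 *: (flat m (h *: 1 + 0) - flat m 0) @[h --> 0^'] --> (0 : R).
    apply/cvgrPdist_le => eps eps0.
    pose c : R := m.+2%:R ^+ m.+2; have c0 : 0 < c by rewrite exprn_gt0 // ltr0n.
    near=> h.
    have h0 : h != 0 by near: h; exact: nbhs_dnbhs_neq.
    have hl : `|h| <= eps / c.
      by near: h; apply: dnbhs0_le; rewrite divr_gt0.
    rewrite [h *: 1]mulr1 addr0 sub0r normrN [X in _ - X]/flat ltxx subr0 normrM.
    rewrite normfV ler_pdivrMl ?normr_gt0 //; apply: le_trans (flat_le_sqr _ _) _.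
    rewrite -real_normK ?num_real // expr2 mulrA mulrC ler_wpM2l //.
    by rewrite mulrC -ler_pdivlMr.
  split; last exact/cvg_lim.
  by apply/cvg_ex; exists 0.
Unshelve. all: by end_near. Qed.

Lemma Ck_flat n k m (O : set 'rV[R]_n) h : open O -> Ck k O h ->
  Ck k O (fun x => flat m (h x)).
Proof.
move=> oO.
have cf m' x : {for x, continuous (flat m')}.
  by apply/differentiable_continuous/derivable1_diffP; have [] := is_derive_flat m' x.
elim: k m => [|k IH] m ch.
  split=> // x Ox; apply: (@continuous_comp _ _ _ h (flat m)); last exact: cf.
  exact: Ck_continuous ch Ox.
have [c d] := ch.
split=> [x Ox|i].
  by apply: (@continuous_comp _ _ _ h (flat m)); [exact: c|exact: cf].
have [d1 d2] := d i.
have D x : O x -> is_derive x (e_ i) (fun x => flat m (h x))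
   ((- m%:R * flat m.+1 (h x) + flat m.+2 (h x)) * 'D_(e_ i) h x).
  move=> Ox; apply: is_derive_line0.
  apply: (@is_derive1_comp _ (flat m) (fun t => h (x + t *: e_ i))).
    by rewrite scale0r addr0; exact: is_derive_flat.
  have := @is_derive_line R n h x (e_ i) 0.
  rewrite scale0r addr0; apply; apply: derivableP; exact: d1.
split=> [x Ox|]; first by have [] := D x Ox.
have h' := CkS ch.
have : Ck k O (fun x => (- m%:R * flat m.+1 (h x) + flat m.+2 (h x)) * 'D_(e_ i) h x).
  apply: Ck_mul => //; apply: Ck_add => //; last exact: IH.
  by apply: Ck_mul => //; [exact: Ck_cst|exact: IH].
by apply: Ck_ext => // x /set_mem Ox; have [_ <-] := D x Ox.
Qed.

End Flat.

Lemma bump_exists (R : realType) n (a : 'rV[R]_n) (r : R) : 0 < r ->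
  exists b : 'rV[R]_n -> R, [/\ forall k, Ck k setT b, b a = 1 &
    forall x, b x != 0 -> ball a r x].
Proof.
move=> r0.
pose h (x : 'rV[R]_n) : R := r ^+ 2 - \sum_i (x 0 i - a 0 i) * (x 0 i - a 0 i).
have oT : open [set: 'rV[R]_n] := openT.
have ch k : Ck k setT h.
  apply: Ck_add => //; first exact: Ck_cst.
  have s : Ck k setT (fun x => -1 * \sum_i (x 0 i - a 0 i) * (x 0 i - a 0 i)).
    apply: Ck_mul => //; first exact: Ck_cst.
    apply: Ck_sum => // i _; apply: Ck_mul => //;
      by apply: Ck_add => //; [exact: Ck_coord|exact: Ck_cst].
  by apply: Ck_ext s => // x _; rewrite mulN1r.
have ha : h a = r ^+ 2 by rewrite /h big1 ?subr0 // => i _; rewrite subrr mul0r.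
have fa : 0 < flat 0 (h a) by rewrite flat_gt0 ha exprn_gt0.
exists (fun x => flat 0 (h x) * (flat 0 (h a))^-1); split.
- by move=> k; apply: Ck_mul => //; [exact: Ck_flat|exact: Ck_cst].
- by rewrite mulfV ?lt0r_neq0.
- move=> x; rewrite mulf_eq0 negb_or => /andP[fx _].
  have : 0 < h x by rewrite -(flat_gt0 0) lt0r fx flat_ge0.
  rewrite subr_gt0 => hx; apply/rV_ballP; split=> // j.
  rewrite distrC -(ltr_pXn2r (n := 2)) ?nnegrE ?(ltW r0) //.
  rewrite real_normK ?num_real //; apply: le_lt_trans hx.
  rewrite (bigD1 j) //= -expr2 lerDl sumr_ge0 // => i _.
  by rewrite -expr2 sqr_ge0.
Qed.

(** * Integrals over the unit interval, and Hadamard's lemma *)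

Section UnitIntegral.
Context (R : realType).
Implicit Types h : R -> R.
Notation mu := (@lebesgue_measure R).

Definition int01 h : R := (\int[mu]_(t in `[0%R, 1%R]) h t)%R.

Definition cont01 h := forall t, 0 <= t <= 1 -> {for t, continuous h}.

Lemma cont01_integrable h : cont01 h -> mu.-integrable `[0%R, 1%R] (EFin \o h).
Proof.
move=> ch; apply: continuous_compact_integrable; first exact: segment_compact.
by apply: continuous_in_subspaceT => t /set_mem; rewrite /= in_itv; exact: ch.
Qed.

Lemma int01_cst (c : R) : int01 (fun=> c) = c.
Proof.
rewrite /int01 Rintegral_cst; last exact: measurable_itv.
have mu1 : mu `[0%R, 1%R]%classic = 1%E.
  by rewrite lebesgue_measure_itv /= lte_fin ltr01 sube0.
by transitivity (c * fine (1%E : \bar R)); [congr (c * fine _)|rewrite mulr1].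
Qed.

Lemma int01_bound h C : cont01 h -> (forall t, 0 <= t <= 1 -> `|h t| <= C) ->
  `|int01 h| <= C.
Proof.
move=> ch hC; have cn : cont01 (fun t => `|h t|).
  by move=> t t01; apply: continuous_comp; [exact: ch|exact: norm_continuous].
apply: le_trans (le_normr_Rintegral _ (cont01_integrable ch)) _ => //.
rewrite -[leRHS]int01_cst; apply: le_Rintegral => //.
- exact: cont01_integrable.
- by apply: cont01_integrable => t _; exact: cst_continuous.
Qed.

Lemma int01_sum (I : finType) (F : I -> R -> R) : (forall i, cont01 (F i)) ->
  int01 (fun t => \sum_i F i t) = \sum_i int01 (F i).
Proof.
move=> cF; rewrite unlock /reducebig.
elim: (index_enum I) => [|i s IH] /=; first exact: int01_cst.
rewrite -IH [LHS]RintegralD //; first exact: cont01_integrable.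
apply: cont01_integrable => t t01.
elim: s {IH} => [|j s IH] /=; first exact: cst_continuous.
by apply: continuousD => //; exact: cF.
Qed.

Lemma int01_scale c h : cont01 h -> int01 (fun t => c * h t) = c * int01 h.
Proof. by move=> ch; rewrite /int01 RintegralZl //; exact: cont01_integrable. Qed.

Lemma int01_ext h k : (forall t, 0 <= t <= 1 -> h t = k t) -> int01 h = int01 k.
Proof.
by move=> hk; apply: eq_Rintegral => t /set_mem; rewrite /= in_itv; exact: hk.
Qed.

Lemma int01_FTC (F f : R -> R) : cont01 f ->
  (forall t : R, 0 <= t <= 1 -> is_derive t (1 : R) F (f t)) ->
  int01 f = F 1 - F 0.
Proof.
move=> cf dF; have cF : cont01 F.
  by move=> t /dF[d _]; apply/differentiable_continuous/derivable1_diffP.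
rewrite /int01 /Rintegral (@continuous_FTC2 _ f F) //.
- by apply: continuous_in_subspaceT => t /set_mem; rewrite /= in_itv; exact: cf.
- split.
  + by move=> t; rewrite in_itv /= => /andP[a b]; have [] := dF t; rewrite ?ltW.
  + by apply: cvg_at_right_filter; apply: cF; rewrite lexx ler01.
  + by apply: cvg_at_left_filter; apply: cF; rewrite lexx ler01.
- move=> t; rewrite in_itv /= => /andP[a b]; rewrite derive1E.
  by have [] := dF t; rewrite ?ltW.
Qed.

(** Differentiation under the integral sign for a parameter in a neighbourhood
    of 0; the constant C plays the role of the integrable majorant. *)
Lemma is_derive_int01 (f : R -> R -> R) (df : R -> R) (C d : R) : 0 < d ->
  (forall s : R, `|s| < d -> cont01 (f s)) ->
  (forall s t : R, `|s| < d -> 0 <= t <= 1 -> derivable (f ^~ t) s 1) ->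
  (forall s t : R, `|s| < d -> 0 <= t <= 1 -> `|'D_1 (f ^~ t) s| <= C) ->
  (forall t : R, 0 <= t <= 1 -> 'D_1 (f ^~ t) 0 = df t) ->
  is_derive (0 : R) (1 : R) (fun s => int01 (f s)) (int01 df).
Proof.
move=> d0 cf Df bf edf.
have I s : `]-d, d[%classic s -> `|s| < d by rewrite /= in_itv /= ltr_norml.
have C0 : 0 <= C.
  by apply: le_trans (bf 0 0 _ _); rewrite ?normr0 ?lexx ?ler01.
have h0 : `]-d, d[%classic (0 : R) by rewrite /= in_itv /= oppr_lt0 d0.
have mI : measurable (`[0%R, 1%R] : set R) by exact: measurable_itv.
have ic s : `]-d, d[%classic s -> mu.-integrable `[0%R, 1%R] (EFin \o f s).
  by move=> /I h; exact: cont01_integrable (cf _ h).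
have iC : mu.-integrable `[0%R, 1%R] (EFin \o (fun=> C)).
  by apply: cont01_integrable => t _; exact: cst_continuous.
have dd s t : `]-d, d[%classic s -> `[0%R, 1%R]%classic t -> derivable (f ^~ t) s 1.
  by move=> /I h; rewrite /= in_itv; exact: Df.
have bb s t : `]-d, d[%classic s -> `[0%R, 1%R]%classic t ->
   `|partial1of2 f s t| <= (fun=> C) t.
  by move=> /I h; rewrite /= in_itv partial1of2E; exact: bf.
have H1 := @derivable_under_integral R _ _ mu f _ mI 0 (- d) d h0 ic dd (fun=> C) (fun=> C0) iC bb.
have H2 := @differentiation_under_integral R _ _ mu f _ mI 0 (- d) d h0 ic dd (fun=> C) (fun=> C0) iC bb.
split; first exact H1.
rewrite -derive1E; transitivity (int01 (partial1of2 f 0)); first exact H2.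
by apply: int01_ext => t t01; rewrite partial1of2E edf.
Qed.

End UnitIntegral.

Lemma continuous_dist (R : realType) (T : topologicalType) (f : T -> R) (x : T) :
  (forall e : R, 0 < e -> \forall y \near x, `|f x - f y| < e) ->
  {for x, continuous f}.
Proof. by move=> h; apply/cvgrPdist_lt. Qed.

Section Hadamard.
Context (R : realType) (n : nat).
Implicit Types (x y a : 'rV[R]_n) (phi : 'rV[R]_n -> R) (S : pred 'I_n).

(** Contracts towards a the coordinates selected by S.  With S full this is the
    homothety of center a and ratio t; with S a singleton it moves along one
    axis.  Both cases of Hadamard's lemma are needed. *)
Definition shrink S a (t : R) x : 'rV[R]_n :=
  \row_j (a 0 j + (if S j then t else 1) * (x 0 j - a 0 j)).

Lemma shrink1 S a x : shrink S a 1 x = x.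
Proof. by apply/rowP => j; rewrite mxE if_same mul1r addrC subrK. Qed.

Lemma shrink_ball S a r t x : 0 <= t <= 1 -> ball a r x -> ball a r (shrink S a t x).
Proof.
move=> /andP[t0 t1] /rV_ballP[r0 h]; apply/rV_ballP; split=> // j.
rewrite mxE opprD addrA subrr sub0r normrN normrM distrC in h *.
apply: le_lt_trans (h j); rewrite -[leRHS]mul1r ler_wpM2r //.
by case: ifP => _; rewrite ger0_norm // ler01.
Qed.

Lemma shrink_line S a t x (i : 'I_n) (s : R) :
  shrink S a t (x + s *: e_ i)
    = shrink S a t x + ((if S i then t else 1) * s) *: e_ i.
Proof.
apply/rowP => j; rewrite !mxE eqxx /=.
have [->|ji] := eqVneq j i; first by ring.
by rewrite !mulr0 !addr0.
Qed.

Lemma is_derive_shrink S a t x :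
  is_derive t (1 : R) (fun t => shrink S a t x)
    (\row_j (if S j then x 0 j - a 0 j else 0)).
Proof.
have dj j : is_derive t (1 : R) (fun t => shrink S a t x 0 j)
    (if S j then x 0 j - a 0 j else 0).
  have -> : (fun t => shrink S a t x 0 j) =
     (fun t => if S j then a 0 j + t * (x 0 j - a 0 j) else x 0 j).
    apply/funext => t'; rewrite mxE; case: ifP => // _.
    by rewrite mul1r addrC subrK.
  case: ifP => _; last exact: is_derive_cst.
  have := is_deriveD (is_derive_cst (a 0 j) t 1)
    (is_deriveM (is_derive_id t (1 : R)) (is_derive_cst (x 0 j - a 0 j) t 1)).
  by move/is_derive_eq; apply; rewrite /GRing.scale /= mulr0 !add0r mulr1.
have D : derivable (fun t => shrink S a t x) t 1.
  by apply/derivable_mxP => i j; rewrite ord1; have [] := dj j.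
split=> //; rewrite derive_mx //; apply/rowP => j.
by rewrite !mxE; have [_ ->] := dj j.
Qed.

Lemma shrink_continuous S a x : continuous (fun t => shrink S a t x).
Proof.
move=> t; apply/differentiable_continuous/derivable1_diffP.
by have [] := is_derive_shrink S a t x.
Qed.

Lemma compact_box (a : 'rV[R]_n) r :
  compact [set v : 'rV[R]_n | forall j, `[a 0 j - r, a 0 j + r]%classic (v 0 j)].
Proof.
by apply: (@rV_compact _ _ (fun j => `[a 0 j - r, a 0 j + r]%classic)) => j;
  exact: segment_compact.
Qed.

Lemma ball_bounded a r r1 phi : 0 < r1 -> r1 < r ->
  (forall z, ball a r z -> {for z, continuous phi}) ->
  exists C, forall z, ball a r1 z -> `|phi z| <= C.
Proof.
move=> r10 r1r cphi.
pose K := [set v : 'rV[R]_n | forall j, `[a 0 j - r1, a 0 j + r1]%classic (v 0 j)].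
have cK : compact K by exact: compact_box.
have Ka : K a by move=> j; rewrite /= in_itv /=; apply/andP; split; lra.
have [|c _ hc] := @EVT_max_rV R n (fun z => `|phi z|) K (ex_intro _ a Ka) cK.
  apply: continuous_in_subspaceT => z /set_mem Kz.
  apply: continuous_comp; last exact: norm_continuous.
  apply: cphi; apply/rV_ballP; split; first exact: lt_trans r1r.
  move=> j; apply: le_lt_trans r1r; have := Kz j.
  by rewrite /= in_itv /= ler_norml => /andP[h1 h2]; apply/andP; split; lra.
exists `|phi c| => z /rV_ballP[_ hz]; apply: hc; apply/mem_set => j.
rewrite /= in_itv /=; have := hz j; rewrite ltr_norml => /andP[h1 h2].
by apply/andP; split; lra.
Qed.

(** The weight t^m makes the family stable under differentiation: each partial
    derivative along a contracted coordinate produces one more factor t. *)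
Definition ray_mean m S a phi x : R := int01 (fun t => t ^+ m * phi (shrink S a t x)).

Lemma ray_cont a r m S phi x : ball a r x ->
  (forall z, ball a r z -> {for z, continuous phi}) ->
  cont01 (fun t => t ^+ m * phi (shrink S a t x)).
Proof.
move=> bx cphi t t01; apply: continuousM; first exact: exprn_continuous.
apply: (@continuous_comp _ _ _ (fun t => shrink S a t x) phi).
  exact: shrink_continuous.
by apply: cphi; exact: shrink_ball.
Qed.

Lemma ray_mean_bound a r m S phi C x : ball a r x ->
  (forall z, ball a r z -> {for z, continuous phi}) ->
  (forall z, ball a r z -> `|phi z| <= C) -> `|ray_mean m S a phi x| <= C.
Proof.
move=> bx cphi hC; apply: int01_bound; first exact: ray_cont bx cphi.
move=> t /[dup] t01 /andP[t0 t1]; rewrite normrM.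
have h := hC _ (shrink_ball S t01 bx); apply: le_trans h.
rewrite -[leRHS]mul1r ler_wpM2r // ger0_norm ?exprn_ge0 //.
by rewrite exprn_ile1.
Qed.

Lemma ball_shrink_radius a r x : ball a r x ->
  exists r1, [/\ 0 < r1, r1 < r & ball a r1 x].
Proof.
move=> bx; have r0 : 0 < r by case/rV_ballP : bx.
move: bx; rewrite -ball_normE /ball_ /= => h.
exists ((`|a - x| + r) / 2); have := normr_ge0 (a - x).
by split; lra.
Qed.

Lemma is_derive_ray_integrand a r m S phi x (i : 'I_n) (s t : R) :
  ball a r (x + s *: e_ i) -> 0 <= t <= 1 -> Ck 1 (ball a r) phi ->
  is_derive s (1 : R) (fun s => t ^+ m * phi (shrink S a t (x + s *: e_ i)))
    (t ^+ (m + S i)%N * 'D_(e_ i) phi (shrink S a t (x + s *: e_ i))).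
Proof.
move=> bs t01 [_ /(_ i)[d _]].
pose w := if S i then t else 1.
have dw : is_derive s (1 : R) (fun s => w * s) w.
  have := is_deriveM (is_derive_cst w s (1 : R)) (is_derive_id s (1 : R)).
  by move/is_derive_eq; apply; rewrite /GRing.scale /= mulr0 addr0 mulr1.
have dp : is_derive (w * s) (1 : R) (fun s => phi (shrink S a t x + s *: e_ i))
    ('D_(e_ i) phi (shrink S a t (x + s *: e_ i))).
  apply: is_derive_line; rewrite -/w -shrink_line; apply: derivableP; apply: d.
  exact: shrink_ball.
have := is_deriveM (is_derive_cst (t ^+ m) s (1 : R)) (is_derive1_comp dp dw).
have -> : (cst (t ^+ m) * ((fun s => phi (shrink S a t x + s *: e_ i)) \o ( *%R w)))
   = (fun s => t ^+ m * phi (shrink S a t (x + s *: e_ i))).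
  by apply/funext => s'; rewrite shrink_line.
move/is_derive_eq; apply; rewrite /GRing.scale /= mulr0 addr0 /w.
by case: (S i); rewrite ?addn1 ?addn0 ?exprSr ?mulr1 // mulrAC mulrA.
Qed.

Lemma is_derive_ray_mean a r m S phi x (i : 'I_n) : ball a r x ->
  Ck 1 (ball a r) phi ->
  is_derive x (e_ i) (ray_mean m S a phi)
    (ray_mean (m + S i)%N S a ('D_(e_ i) phi) x).
Proof.
move=> bx cphi.
have [r1 [r10 r1r bx1]] := ball_shrink_radius bx.
have cont0 z : ball a r z -> {for z, continuous phi} by case: cphi => + _; apply.
have [C hC] : exists C, forall z, ball a r1 z -> `|'D_(e_ i) phi z| <= C.
  by apply: ball_bounded r1r _ => //; case: cphi => _ /(_ i)[_ [+ _]]; apply.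
pose d := r1 - `|a - x|.
have d0 : 0 < d by move: bx1; rewrite -ball_normE /ball_ /= /d subr_gt0.
have bs (s : R) : `|s| < d -> ball a r1 (x + s *: e_ i).
  rewrite -ball_normE /ball_ /= opprD addrA => sd.
  apply: le_lt_trans (ler_normB _ _) _; rewrite -ltrBrDl.
  apply: le_lt_trans sd; rewrite normrZ -[leRHS]mulr1 ler_wpM2l //.
  rewrite [leLHS]/Num.Def.normr /= mx_normrE; apply/bigmax_leP; split=> // -[j k] _.
  by rewrite /= mxE; case: (_ && _); rewrite ?normr1 ?normr0.
have bsr (s : R) : `|s| < d -> ball a r (x + s *: e_ i).
  by move=> /bs; apply: le_ball; apply: ltW.
apply: is_derive_line0.
apply: (@is_derive_int01 R (fun s t => t ^+ m * phi (shrink S a t (x + s *: e_ i))) _ C d) => //.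
- by move=> s sd; apply: ray_cont (bsr s sd) cont0.
- by move=> s t sd t01; have [] := is_derive_ray_integrand m S (bsr s sd) t01 cphi.
- move=> s t sd /[dup] t01 /andP[t0 t1].
  have [_ ->] := is_derive_ray_integrand m S (bsr s sd) t01 cphi.
  rewrite normrM; apply: le_trans (hC _ (shrink_ball S t01 (bs s sd))).
  by rewrite -[leRHS]mul1r ler_wpM2r // ger0_norm ?exprn_ge0 // exprn_ile1.
- move=> t t01; have x0 : ball a r (x + 0 *: e_ i) by apply: bsr; rewrite normr0.
  have [_ ->] := is_derive_ray_integrand m S x0 t01 cphi.
  by rewrite scale0r addr0.
Qed.

(** The partial derivatives of a mean are means of partial derivatives, so that
    only continuity is left; it follows from [mvt_ball], since those partial
    derivatives are locally bounded. *)
Lemma Ck_ray_mean k a r m S phi : smooth_on (ball a r) phi ->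
  Ck k (ball a r) (ray_mean m S a phi).
Proof.
elim: k m phi => [|k IH] m phi sphi.
  split=> // x bx; have [r1 [r10 r1r bx1]] := ball_shrink_radius bx.
  have cphi : Ck 1 (ball a r) phi by exact: sphi.
  have sub z : ball a r1 z -> ball a r z by apply: le_ball; apply: ltW.
  have /choice[C hC] (i : 'I_n) : exists C, forall z, ball a r1 z -> `|'D_(e_ i) phi z| <= C.
    by apply: ball_bounded r1r _ => //; case: cphi => _ /(_ i)[_ [+ _]]; apply.
  have dT z (i : 'I_n) : ball a r1 z -> `|'D_(e_ i) (ray_mean m S a phi) z| <= C i.
    move=> bz; have [_ ->] := is_derive_ray_mean m S i (sub _ bz) cphi.
    apply: (@ray_mean_bound a r1) => //; last exact: hC.
    by move=> y /sub; case: cphi => _ /(_ i)[_ [+ _]]; apply.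
  pose K := \sum_i C i.
  have K0 : 0 <= K by apply: sumr_ge0 => i _; apply: le_trans (dT x i bx1).
  have lip y : ball a r1 y ->
      `|ray_mean m S a phi x - ray_mean m S a phi y| <= K * `|x - y|.
    move=> b_y; have [|xi bxi ->] := @mvt_ball R n a r1 (ray_mean m S a phi) y x _ b_y bx1.
      by move=> z /sub bz i; have [] := is_derive_ray_mean m S i bz cphi.
    apply: le_trans (ler_norm_sum _ _ _) _; rewrite mulr_suml; apply: ler_sum => i _.
    rewrite normrM mulrC; apply: ler_pM => //; first exact: dT.
    by have := rV_norm_coord (x - y) i; rewrite !mxE.
  apply: continuous_dist => e e0.
  have near1 : \forall y \near x, ball a r1 y by apply: open_near => //; exact: ball_open.
  have near2 : \forall y \near x, ball x (e / (K + 1)) y.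
    by apply: nbhsx_ballx; rewrite divr_gt0 // ltr_wpDl.
  apply: (@filterS2 _ (nbhs x) _ _ _ _ _ near1 near2) => y b1.
  rewrite -ball_normE /ball_ /= ltr_pdivlMr ?ltr_wpDl // => b2.
  apply: le_lt_trans (lip _ b1) _; apply: le_lt_trans b2.
  by rewrite mulrC ler_wpM2l // lerDl.
have cphi : Ck 1 (ball a r) phi by exact: sphi.
split=> [x bx|i]; first exact: (Ck_continuous (IH m phi sphi)).
split=> [x bx|]; first by have [] := is_derive_ray_mean m S i bx cphi.
have : Ck k (ball a r) (ray_mean (m + S i)%N S a ('D_(e_ i) phi)).
  by apply: IH => l; have [_ /(_ i)[]] := sphi l.+1.
apply: Ck_ext; first exact: ball_open.
by move=> x /set_mem bx; have [_ <-] := is_derive_ray_mean m S i bx cphi.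
Qed.

(** The fundamental theorem of calculus along t |-> shrink S a t x, whose
    derivative has the coordinates x_i - a_i for i in S. *)
Lemma hadamard a r S phi x : smooth_on (ball a r) phi -> ball a r x ->
  phi x = phi (shrink S a 0 x)
   + \sum_(i | S i) (x 0 i - a 0 i) * ray_mean 0 S a ('D_(e_ i) phi) x.
Proof.
move=> sphi bx; have cphi : Ck 1 (ball a r) phi by exact: sphi.
have oB : open (ball a r) by exact: ball_open.
have cont (i : 'I_n) : cont01 (fun t => t ^+ 0 * 'D_(e_ i) phi (shrink S a t x)).
  by apply: (@ray_cont a r 0 S ('D_(e_ i) phi) x bx); case: cphi => _ /(_ i)[_ [+ _]].
pose v (i : 'I_n) := if S i then x 0 i - a 0 i else 0.
have -> : \sum_(i | S i) (x 0 i - a 0 i) * ray_mean 0 S a ('D_(e_ i) phi) x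
   = int01 (fun t => \sum_i v i * (t ^+ 0 * 'D_(e_ i) phi (shrink S a t x))).
  rewrite int01_sum => [|i t t01]; last first.
    by apply: continuousM; [exact: cst_continuous|exact: cont].
  rewrite big_mkcond; apply: eq_bigr => i _; rewrite int01_scale; last exact: cont.
  by rewrite /v; case: ifP; rewrite ?mul0r.
set h := (fun t => \sum_i v i * _).
suff -> : int01 h = phi (shrink S a 1 x) - phi (shrink S a 0 x).
  by rewrite shrink1 addrC subrK.
have hE t : h t = \sum_i v i * 'D_(e_ i) phi (shrink S a t x).
  by apply: eq_bigr => i _; rewrite expr0 mul1r.
apply: (@int01_FTC R (fun t => phi (shrink S a t x))).
- move=> t t01.
  have [cs _] : Ck 0 (ball a r) (fun y => \sum_i v i * 'D_(e_ i) phi y).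
    apply: Ck_sum => [|i _]; first exact: ball_open.
    apply: Ck_mul; [exact: ball_open|apply: Ck_cst; exact: ball_open|].
    by case: cphi => _ /(_ i)[].
  have := @continuous_comp _ _ _ (fun t => shrink S a t x) _ t
     (@shrink_continuous S a x t) (cs _ (shrink_ball S t01 bx)).
  by move: hE => /funext ->.
- move=> t t01; rewrite hE.
  have := is_derive_comp_line oB (shrink_ball S t01 bx) cphi
    (is_derive_shrink S a t x).
  by under eq_bigr do rewrite mxE.
Qed.

End Hadamard.

(** * Gronwall's lemma and division by a radial field *)

Lemma gronwall_ball (R : realType) n (a : 'rV[R]_n) (r C : R)
    (eta : 'rV[R]_n -> R) : open (ball a r) ->
  Ck 1 (ball a r) eta -> (forall x, 0 <= eta x) -> eta a = 0 ->
  (forall x i, ball a r x -> `|'D_(e_ i) eta x| <= C * eta x) ->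
  forall x, ball a r x -> eta x = 0.
Proof.
move=> oB ceta eta0 etaa bound x bx.
pose k (t : R) := eta (shrink predT a t x).
pose v (j : 'I_n) := x 0 j - a 0 j.
pose k' (t : R) := \sum_j v j * 'D_(e_ j) eta (shrink predT a t x).
have dk (t : R) : 0 <= t <= 1 -> is_derive t (1 : R) k (k' t).
  move=> t01; have := is_derive_comp_line oB (shrink_ball predT t01 bx) ceta
    (is_derive_shrink predT a t x).
  by under eq_bigr do rewrite mxE.
pose K := \sum_j `|v j| * C.
have k'le (t : R) : 0 <= t <= 1 -> k' t <= K * k t.
  move=> t01; rewrite /K mulr_suml; apply: ler_sum => j _.
  apply: le_trans (ler_norm _) _; rewrite normrM -mulrA ler_wpM2l //.
  by apply: bound; exact: shrink_ball.
pose e (t : R) := expR (- K * t).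
have de (t : R) : is_derive t (1 : R) e (e t * - K).
  apply: is_derive1_comp.
  have := is_deriveM (is_derive_cst (- K) t (1 : R)) (is_derive_id t (1 : R)).
  by move/is_derive_eq; apply; rewrite /GRing.scale /= mulr0 addr0 mulr1.
have dm (t : R) : 0 <= t <= 1 -> is_derive t (1 : R) (k * e) (k t *: (e t * - K) + e t *: k' t).
  by move=> t01; exact: is_deriveM (dk t t01) (de t).
have cm (t : R) : 0 <= t <= 1 -> {for t, continuous (k * e)}.
  by move=> /dm[d _]; apply/differentiable_continuous/derivable1_diffP.
have kx : k 1 = eta x by rewrite /k shrink1.
have k0 : k 0 = 0.
  by rewrite /k (_ : shrink _ _ _ _ = a) //; apply/rowP => j; rewrite mxE mul0r addr0.
have : (k * e) 1 <= (k * e) 0.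
  apply: (@ler0_derive1_nincr R (k * e) 0 1) => //.
  - by move=> t; rewrite in_itv /= => /andP[t0 t1]; have [] := dm t; rewrite ?ltW.
  - move=> t; rewrite in_itv /= => /andP[t0 t1].
    have t01 : 0 <= t <= 1 by rewrite !ltW.
    rewrite derive1E; have [_ ->] := dm t t01; rewrite /GRing.scale /=.
    have := k'le t t01; have := expR_gt0 (- K * t); rewrite -/(e t) => et le.
    have -> : k t * (e t * - K) + e t * k' t = e t * (k' t - K * k t) by ring.
    by rewrite pmulr_rle0 // subr_le0.
  - by apply: continuous_in_subspaceT => t /set_mem; rewrite /= in_itv; exact: cm.
rewrite -[X in X <= _]/(k 1 * e 1) -[X in _ <= X]/(k 0 * e 0) kx k0 mul0r.
rewrite pmulr_lle0 ?expR_gt0 // => h1.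
by apply/eqP; rewrite eq_le h1 eta0.
Qed.

Section RadialDivision.
Context (R : realType) (n : nat).
Implicit Types (x a : 'rV[R]_n).

Lemma continuous_line_eq0 (F : 'rV[R]_n -> R) x e : {for x, continuous F} ->
  (\forall s \near (0 : R), s != 0 -> F (x + s *: e) = 0) -> F x = 0.
Proof.
move=> cF h; apply: contrapT => /eqP Fx.
have nF : \forall y \near x, F y != 0.
  exact: (cF [set y | y != 0] (open_nbhs_nbhs (conj (@open_neq R 0) Fx))).
have line : {for (0 : R), continuous (fun s : R => x + s *: e)}.
  apply: continuousD; first exact: cst_continuous.
  by apply: scalel_continuous.
have nL : \forall s \near (0 : R), F (x + s *: e) != 0.
  by have := line (fun y => F y != 0); rewrite /= scale0r addr0; apply.
have : \forall s \near (0 : R)^', False.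
  near=> s.
  have s0 : s != 0 by near: s; exact: nbhs_dnbhs_neq.
  have hs : s != 0 -> F (x + s *: e) = 0 by near: s; exact: nbhs_dnbhs.
  have ns : F (x + s *: e) != 0 by near: s; exact: nbhs_dnbhs.
  by rewrite hs // eqxx in ns.
by move=> /filter_ex[].
Unshelve. all: by end_near. Qed.

Lemma Ck_det k (O : set 'rV[R]_n) m (A : 'rV[R]_n -> 'M[R]_m) : open O ->
  (forall i j, Ck k O (fun x => A x i j)) -> Ck k O (fun x => \det (A x)).
Proof.
move=> oO cA; rewrite /determinant.
apply: Ck_sum => // s _; apply: Ck_mul => //; first exact: Ck_cst.
by apply: Ck_prod.
Qed.

(** Up to sign, the entries of the adjugate are determinants of submatrices. *)
Lemma Ck_adj k (O : set 'rV[R]_n) m (A : 'rV[R]_n -> 'M[R]_m) i j : open O ->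
  (forall i j, Ck k O (fun x => A x i j)) -> Ck k O (fun x => (\adj (A x)) i j).
Proof.
move=> oO cA.
apply: (@Ck_ext _ _ _ _ (fun x => (-1) ^+ (j + i) * \det (row' j (col' i (A x))))) => //.
  by move=> x _; rewrite mxE.
apply: Ck_mul => //; first exact: Ck_cst.
apply: Ck_det => // i' j'.
by apply: Ck_ext (cA (lift j i') (lift i j')) => // x _; rewrite !mxE.
Qed.

(** If V = rho alpha off the zeros of alpha, and alpha has a nondegenerate,
    hence isolated, zero at a, then rho extends smoothly to a.  Write
    alpha = A(x) (x - a) by Hadamard's lemma and let P be the component k of
    adj(A) V = rho det(A) (x - a).  It vanishes on the hyperplane x_k = a_k
    (at a itself, by continuity along another axis, whence n > 1), so that
    Hadamard's lemma along the axis k divides it by x_k - a_k. *)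
Lemma radial_division a (r : R) (alpha V : 'I_n -> 'rV[R]_n -> R) (rho : 'rV[R]_n -> R) :
  (1 < n)%N -> 0 < r ->
  (forall i, smooth_on (ball a r) (alpha i)) ->
  (forall i, smooth_on (ball a r) (V i)) ->
  (forall i, alpha i a = 0) ->
  \det (\matrix_(i, j) 'D_(e_ j) (alpha i) a) != 0 ->
  (forall x, ball a r x -> (exists i, alpha i x <> 0) ->
     forall i, V i x = rho x * alpha i x) ->
  exists (r1 : R) (sigma : 'rV[R]_n -> R), [/\ 0 < r1, r1 <= r, smooth_on (ball a r1) sigma,
    forall x i, ball a r1 x -> V i x = sigma x * alpha i x &
    forall x, ball a r1 x -> x != a -> exists i, alpha i x <> 0].
Proof.
move=> hn r0 sal sV ala deta Vrho.
pose A x : 'M[R]_n := \matrix_(i, j) ray_mean 0 predT a ('D_(e_ j) (alpha i)) x.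
pose d x := \det (A x).
have oB s : open (ball a s) by exact: ball_open.
have sA k i j : Ck k (ball a r) (fun x => A x i j).
  apply: (@Ck_ext _ _ _ _ (ray_mean 0 predT a ('D_(e_ j) (alpha i)))) => //.
    by move=> x _; rewrite mxE.
  by apply: Ck_ray_mean => l; have [_ /(_ j)[]] := sal i l.+1.
have sd k : Ck k (ball a r) d by apply: Ck_det.
have Aa : A a = \matrix_(i, j) 'D_(e_ j) (alpha i) a.
  apply/matrixP => i j; rewrite !mxE.
  have shr t : shrink predT a t a = a.
    by apply/rowP => l; rewrite mxE subrr mulr0 addr0.
  rewrite -[RHS](int01_cst ('D_(e_ j) (alpha i) a)); apply: int01_ext => t _.
  by rewrite expr0 mul1r shr.
have [r1 [r10 r1r d0]] : exists r1, [/\ 0 < r1, r1 <= r & forall x, ball a r1 x -> d x != 0].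
  have ca : {for a, continuous d} by apply: Ck_continuous (sd 0%N) (ballxx _ r0).
  have da : d a != 0 by rewrite /d Aa.
  have : \forall x \near a, d x != 0.
    exact: (ca [set y | y != 0] (open_nbhs_nbhs (conj (@open_neq R 0) da))).
  move=> /nbhs_ballP[s /= s0 hs]; exists (Num.min r s); split.
  - by rewrite lt_min r0 s0.
  - by rewrite ge_min lexx.
  - by move=> x bx; apply: hs; apply: le_ball bx; rewrite ge_min lexx orbT.
have sub : ball a r1 `<=` ball a r by move=> x; exact: le_ball.
have alE x i : ball a r1 x -> alpha i x = \sum_j A x i j * (x 0 j - a 0 j).
  move=> /sub bx; rewrite (hadamard predT (sal i) bx).
  have -> : shrink predT a 0 x = a by apply/rowP => j; rewrite mxE mul0r addr0.
  by rewrite ala add0r; apply: eq_bigr => j _; rewrite mxE mulrC.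
have adjE x k : ball a r1 x ->
    \sum_i (\adj (A x)) k i * alpha i x = d x * (x 0 k - a 0 k).
  move=> bx.
  have -> : \sum_i (\adj (A x)) k i * alpha i x
     = (\adj (A x) *m (A x *m (\col_j (x 0 j - a 0 j)))) k 0.
    rewrite mxE; apply: eq_bigr => i _; congr (_ * _).
    by rewrite alE // [RHS]mxE; apply: eq_bigr => j _; congr (_ * _); rewrite mxE.
  by rewrite mulmxA mul_adj_mx mul_scalar_mx !mxE.
have alpha_neq0 x : ball a r1 x -> x != a -> exists i, alpha i x <> 0.
  move=> bx xa; apply: contrapT => nex; case/eqP: xa; apply/rowP => k.
  have al0 i : alpha i x = 0 by apply: contrapT => h; apply: nex; exists i.
  have := adjE x k bx; rewrite big1 => [|i _]; last by rewrite al0 mulr0.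
  by move=> /esym/eqP; rewrite mulf_eq0 (negbTE (d0 _ bx)) subr_eq0 => /eqP.
pose k := Ordinal (ltnW hn).
pose P x := \sum_i (\adj (A x)) k i * V i x.
have sP l : Ck l (ball a r1) P.
  apply: (Ck_sub sub); apply: Ck_sum => // i _; apply: Ck_mul => //; last exact: sV.
  exact: Ck_adj.
have PE x : ball a r1 x -> x != a -> P x = rho x * (d x * (x 0 k - a 0 k)).
  move=> bx xa; rewrite -adjE // mulr_sumr; apply: eq_bigr => i _.
  by rewrite (Vrho x (sub _ bx) (alpha_neq0 _ bx xa)) mulrCA.
have near_line x e : ball a r1 x -> \forall s \near (0 : R), ball a r1 (x + s *: e).
  move=> bx; have line : {for (0 : R), continuous (fun s : R => x + s *: e)}.
    apply: continuousD; first exact: cst_continuous.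
    by apply: scalel_continuous.
  have := line (ball a r1); rewrite /= scale0r addr0; apply.
  by apply: open_nbhs_nbhs.
have Pa : P a = 0.
  (* Along a second axis, P vanishes outside of a. *)
  apply: (@continuous_line_eq0 _ _ (e_ (Ordinal hn))).
    exact: Ck_continuous (sP 0%N) (ballxx _ r10).
  have := near_line a (e_ (Ordinal hn)) (ballxx _ r10).
  apply: filterS => s bs s0; rewrite PE //.
    by rewrite !mxE eqxx /= mulr0 addr0 subrr !mulr0.
  apply/eqP => /rowP/(_ (Ordinal hn)); rewrite !mxE !eqxx mulr1 => /eqP.
  by rewrite -subr_eq0 addrAC subrr add0r (negbTE s0).
have P0 x : ball a r1 x -> x 0 k = a 0 k -> P x = 0.
  move=> bx xk; have [->//|xa] := eqVneq x a.
  by rewrite PE // xk subrr !mulr0.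
pose W := ray_mean 0 (pred1 k) a ('D_(e_ k) P).
have sW l : Ck l (ball a r1) W.
  by apply: Ck_ray_mean => l'; have [_ /(_ k)[]] := sP l'.+1.
have PW x : ball a r1 x -> P x = (x 0 k - a 0 k) * W x.
  move=> bx; rewrite (hadamard (pred1 k) sP bx) big_pred1_eq P0 ?add0r //.
    by apply: shrink_ball bx; rewrite lexx ler01.
  by rewrite mxE /= mul0r addr0.
pose sigma x := W x * (d x)^-1.
have ssigma l : Ck l (ball a r1) sigma.
  by apply: Ck_mul => //; apply: Ck_inv => //; apply: Ck_sub (sd l).
exists r1, sigma; split=> // x i bx.
have off y : ball a r1 y -> y 0 k != a 0 k -> V i y = sigma y * alpha i y.
  move=> bY yk; have ya : y != a by apply: contraNneq yk => ->.
  have h : W y = rho y * d y.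
    have := PW y bY; rewrite PE // mulrA mulrC => /mulfI -> //.
    by rewrite subr_eq0.
  rewrite (Vrho y (sub _ bY) (alpha_neq0 _ bY ya)); congr (_ * _).
  by rewrite /sigma h mulfK // d0.
have [xk|] := eqVneq (x 0 k) (a 0 k); last exact: off.
apply/eqP; rewrite -subr_eq0; apply/eqP.
apply: (@continuous_line_eq0 (fun x => V i x - sigma x * alpha i x) x (e_ k)).
  have c1 : {for x, continuous (V i)} by exact: Ck_continuous (sV i 0%N) (sub _ bx).
  have c2 : {for x, continuous sigma} by exact: Ck_continuous (ssigma 0%N) bx.
  have c3 : {for x, continuous (alpha i)} by exact: Ck_continuous (sal i 0%N) (sub _ bx).
  by apply: continuousB => //; exact: continuousM.
have := near_line x (e_ k) bx; apply: filterS => s bs s0.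
rewrite off ?subrr // !mxE !eqxx mulr1 xk.
by rewrite -subr_eq0 addrAC subrr add0r.
Qed.

End RadialDivision.

(** * Smooth functions on a manifold *)

Lemma open_preimage_on (S T : topologicalType) (O : set S) (U : set T) (h : S -> T) :
  open O -> open U -> (forall x, O x -> {for x, continuous h}) ->
  open (O `&` h @^-1` U).
Proof.
move=> oO oU ch; rewrite openE => x [Ox Ux]; apply: filterI.
  exact: open_nbhs_nbhs.
by apply: ch => //; exact: open_nbhs_nbhs.
Qed.

Section SmoothFunctions.
Context (R : realType) (n : nat) (M : manifold R n).
Implicit Types (f h : M -> R) (c : chart R M n) (p q : M).

Definition extend c (psi : 'rV[R]_n -> R) : M -> R :=
  fun q => if q \in chart_dom c then psi (chart_map c q) else 0.

Lemma open_chart_inv c (U : set M) : open U ->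
  open (chart_cod c `&` chart_inv c @^-1` U).
Proof.
move=> oU; apply: open_preimage_on => //; first exact: chart_cod_open.
exact: chart_inv_continuous.
Qed.

(** It is enough to look at one chart around each point, because the transition
    maps are smooth. *)
Lemma smooth_local f :
  (forall p, exists c (O : set 'rV[R]_n), [/\ atlas c, chart_dom c p, open O,
     O (chart_map c p) & smooth_on O (f \o chart_inv c)]) -> smooth f.
Proof.
move=> loc c' ac' k; apply: Ck_local => x cx.
have [c [V [ac dp oO Op sf]]] := loc (chart_inv c' x).
pose U := chart_cod c' `&` chart_inv c' @^-1` (chart_dom c `&` chart_map c @^-1` V).
have oU : open U.
  apply/open_chart_inv/open_preimage_on => //; first exact: chart_dom_open.
  exact: chart_map_continuous.
exists U => //.
have cf : Ck k U ((f \o chart_inv c) \o (chart_map c \o chart_inv c')).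
  apply: (Ck_comp oU oO) => [|j|]; last exact: sf.
    by move=> y [_ [_ ?]].
  have oT : open (chart_cod c' `&` chart_inv c' @^-1` chart_dom c).
    by apply: open_chart_inv; exact: chart_dom_open.
  apply: (@Ck_sub _ _ _ (chart_cod c' `&` chart_inv c' @^-1` chart_dom c)).
    by move=> y [? []].
  exact: (Ck_component j oT (atlas_compatible ac' ac k)).
apply: (Ck_ext oU _ cf) => y /set_mem [_ [dy _]] /=.
by rewrite chart_mapK.
Qed.

Lemma smooth_continuous f p : smooth f -> {for p, continuous f}.
Proof.
move=> sf; have [c ac dp] := atlas_cover p.
have h : \forall q \near p, (f \o chart_inv c) (chart_map c q) = f q.
  have : \forall q \near p, chart_dom c q.
    by apply: open_nbhs_nbhs; split => //; exact: chart_dom_open.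
  by apply: filterS => q dq /=; rewrite chart_mapK.
have : {for p, continuous ((f \o chart_inv c) \o chart_map c)}.
  apply: (@continuous_comp _ _ _ (chart_map c) (f \o chart_inv c)).
    exact: chart_map_continuous.
  exact: Ck_continuous (sf c ac 0%N) (chart_map_cod dp).
rewrite /prop_for /continuous_at /= chart_mapK // => cf.
exact: cvg_trans (near_eq_cvg h) cf.
Qed.

Lemma smooth_ext f h : f =1 h -> smooth f -> smooth h.
Proof. by move=> /funext ->. Qed.

Lemma smooth_cst (a : R) : smooth (fun _ : M => a).
Proof. by move=> c ac k; apply: Ck_cst; exact: chart_cod_open. Qed.

Lemma smoothD f h : smooth f -> smooth h -> smooth (fun q => f q + h q).
Proof.
move=> sf sh c ac k; apply: Ck_add; [exact: chart_cod_open|exact: sf|exact: sh].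
Qed.

Lemma smoothM f h : smooth f -> smooth h -> smooth (fun q => f q * h q).
Proof.
move=> sf sh c ac k; apply: Ck_mul; [exact: chart_cod_open|exact: sf|exact: sh].
Qed.

Lemma smoothN f : smooth f -> smooth (fun q => - f q).
Proof.
move=> sf; apply: (@smooth_ext (fun q => -1 * f q)); last first.
  by apply: smoothM => //; exact: smooth_cst.
by move=> q; rewrite mulN1r.
Qed.

Lemma smoothB f h : smooth f -> smooth h -> smooth (fun q => f q - h q).
Proof. by move=> sf sh; apply: smoothD => //; exact: smoothN. Qed.

Lemma smooth_sum (I : Type) (s : seq I) (F : I -> M -> R) :
  (forall i, smooth (F i)) -> smooth (fun q => \sum_(i <- s) F i q).
Proof.
move=> sF c ac k; apply: Ck_sum; first exact: chart_cod_open.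
by move=> i _; exact: sF.
Qed.

(** Off the chart the extension vanishes near every point: the support lies in
    the image of a compact cube, which is closed because M is Hausdorff. *)
Lemma smooth_extend c psi a (r r' : R) : atlas c ->
  r < r' -> ball a r' `<=` chart_cod c ->
  (forall x, psi x != 0 -> ball a r x) -> smooth_on (chart_cod c) psi ->
  smooth (extend c psi).
Proof.
move=> ac rr' sub supp spsi; apply: smooth_local => p.
case: (pselect (chart_dom c p)) => dp.
  exists c, (chart_cod c); split=> //; first exact: chart_cod_open.
    exact: chart_map_cod.
  move=> k; apply: Ck_ext (spsi k); first exact: chart_cod_open.
  move=> x /set_mem cx; rewrite /extend /=.
  by rewrite mem_set ?chart_invK //; exact: chart_inv_dom.
pose K := [set v : 'rV[R]_n | forall j, `[a 0 j - r, a 0 j + r]%classic (v 0 j)].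
(* For r' <= 0 the balls are empty and psi is zero. *)
have [r0|r0] := leP r' 0.
  have ext0 : extend c psi = cst 0.
    apply/funext => q; rewrite /extend; case: ifP => // _.
    apply/eqP; apply: contraT => /supp/rV_ballP[h _].
    by have := lt_trans h rr'; rewrite ltNge r0.
  have [c' ac' dp'] := atlas_cover p.
  exists c', (chart_cod c'); rewrite ext0; split=> //; first exact: chart_cod_open.
    exact: chart_map_cod.
  by move=> k; apply: Ck_cst; exact: chart_cod_open.
have Kcod : K `<=` chart_cod c.
  move=> x Kx; apply: sub; apply/rV_ballP; split=> // j; apply: le_lt_trans rr'.
  have := Kx j; rewrite /= in_itv /= ler_norml => /andP[h1 h2].
  by apply/andP; split; lra.
have closedK : closed [set chart_inv c x | x in K].
  apply: compact_closed; first exact: manifold_hausdorff.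
  apply: continuous_compact; last exact: compact_box.
  apply: continuous_in_subspaceT => x /set_mem /Kcod; exact: chart_inv_continuous.
have [c' ac' dp'] := atlas_cover p.
have oU : open (chart_cod c' `&` chart_inv c' @^-1` ~` [set chart_inv c x | x in K]).
  by apply: open_chart_inv; exact: closed_openC.
eexists c', _; split; [exact: ac'|exact: dp'|exact: oU| |].
  split; first exact: chart_map_cod.
  rewrite /= chart_mapK // => -[x Kx xp]; apply: dp.
  by rewrite -xp; apply: chart_inv_dom; exact: Kcod.
move=> k; apply: (Ck_ext oU) (Ck_cst k 0 oU) => x /set_mem [cx nK].
rewrite /extend /=; case: ifP => // /set_mem dq.
apply/esym/eqP; apply: contraT => /supp/rV_ballP[_ bx]; exfalso; apply: nK => /=.
exists (chart_map c (chart_inv c' x)); last exact: chart_mapK.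
move=> j; rewrite /= in_itv /=; have := bx j; rewrite ltr_norml => /andP[h1 h2].
by apply/andP; split; lra.
Qed.

Lemma near_chart c p (P : M -> Prop) : chart_dom c p ->
  (\forall q \near p, P q) -> \forall x \near chart_map c p, P (chart_inv c x).
Proof.
move=> dp nP; have := chart_inv_continuous (chart_map_cod dp).
by rewrite /prop_for /continuous_at chart_mapK //; apply.
Qed.

Lemma near_chart_map c p (P : 'rV[R]_n -> Prop) : chart_dom c p ->
  (\forall x \near chart_map c p, P x) -> \forall q \near p, chart_dom c q /\ P (chart_map c q).
Proof.
move=> dp nP; apply: filterI.
  by apply: open_nbhs_nbhs; split => //; exact: chart_dom_open.
by have := chart_map_continuous dp; apply.
Qed.

End SmoothFunctions.

(** * Tangent vectors and local frames *)

Section Tangent.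
Context (R : realType) (n : nat) (M : manifold R n).
Implicit Types (f h : M -> R) (c : chart R M n) (p q : M) (v w : functional M)
  (X Y : field M).

Lemma tangentD p v f h : tangent p v -> smooth f -> smooth h ->
  v (fun q => f q + h q) = v f + v h.
Proof.
move=> [lin _ _] sf sh; have := lin 1 f h sf sh; rewrite mul1r => <-.
by congr v; apply/funext => q; rewrite mul1r.
Qed.
Arguments tangentD {p v f h}.

Lemma tangent0f p v : tangent p v -> v (fun=> 0) = 0.
Proof.
move=> tv; have s0 := @smooth_cst R n M 0; have := tangentD tv s0 s0.
by under eq_fun do rewrite addr0; move=> /eqP; rewrite -subr_eq0 opprD addNKr oppr_eq0 => /eqP.
Qed.
Arguments tangent0f {p v}.

Lemma tangentM p v f h : tangent p v -> smooth f -> smooth h ->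
  v (fun q => f q * h q) = f p * v h + h p * v f.
Proof. by move=> [_ leib _]; apply: leib. Qed.
Arguments tangentM {p v f h}.

Lemma tangentZ p v (a : R) f : tangent p v -> smooth f ->
  v (fun q => a * f q) = a * v f.
Proof.
move=> tv sf; have [lin _ _] := tv.
have := lin a f _ sf (@smooth_cst R n M 0); rewrite (tangent0f tv) addr0 => <-.
by congr v; apply/funext => q; rewrite addr0.
Qed.
Arguments tangentZ {p v} a {f}.

Lemma tangent_cst p v (a : R) : tangent p v -> v (fun=> a) = 0.
Proof.
move=> tv; have s1 := @smooth_cst R n M 1.
have v1 : v (fun=> 1) = 0.
  have := tangentM tv s1 s1; under eq_fun do rewrite mulr1.
  by rewrite !mul1r => /eqP; rewrite -subr_eq0 opprD addNKr oppr_eq0 => /eqP.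
have := tangentZ a tv s1; under eq_fun do rewrite mulr1.
by rewrite v1 mulr0.
Qed.
Arguments tangent_cst {p v} a.

Lemma tangentB p v f h : tangent p v -> smooth f -> smooth h ->
  v (fun q => f q - h q) = v f - v h.
Proof.
move=> tv sf sh; rewrite (tangentD tv sf (smoothN sh)); congr (_ + _).
rewrite -mulN1r -(tangentZ _ tv sh); congr v; apply/funext => q.
by rewrite mulN1r.
Qed.
Arguments tangentB {p v f h}.

Lemma tangent_sum p v (s : seq 'I_n) (F : 'I_n -> M -> R) : tangent p v ->
  (forall i, smooth (F i)) ->
  v (fun q => \sum_(i <- s) F i q) = \sum_(i <- s) v (F i).
Proof.
move=> tv sF; elim: s => [|i s IH].
  by under eq_fun do rewrite big_nil; rewrite big_nil (tangent0f tv).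
under eq_fun do rewrite big_cons.
by rewrite big_cons -IH; apply: (tangentD tv) => //; exact: smooth_sum.
Qed.
Arguments tangent_sum {p v} s {F}.

Lemma tangent_add p v w : tangent p v -> tangent p w -> tangent p (v + w).
Proof.
move=> [l1 d1 n1] [l2 d2 n2]; split=> [a f h sf sh|f h sf sh|f nf].
- rewrite -[LHS]/(v _ + w _) -![(v + w) _]/(v _ + w _) l1 // l2 //; ring.
- rewrite -[LHS]/(v _ + w _) -![(v + w) _]/(v _ + w _) d1 // d2 //; ring.
- by rewrite -[LHS]/(v _ + w _) n1 // n2 // addr0.
Qed.

Lemma tangent_scale p (a : R) v : tangent p v -> tangent p (a *: v).
Proof.
move=> [l1 d1 n1]; split=> [b f h sf sh|f h sf sh|f nf].
- rewrite -[LHS]/(a * v _) -![(a *: v) _]/(a * v _) l1 //; ring.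
- rewrite -[LHS]/(a * v _) -![(a *: v) _]/(a * v _) d1 //; ring.
- by rewrite -[LHS]/(a * v _) n1 // mulr0.
Qed.

Lemma tangent0 p : tangent p (0 : functional M).
Proof.
split=> [a f h _ _|f h _ _|//]; rewrite -![(0 : functional M) _]/(0 : R); ring.
Qed.

Lemma smooth_fieldD X Y : smooth_field X -> smooth_field Y -> smooth_field (X + Y).
Proof.
move=> [tX sX] [tY sY]; split=> [p|f sf]; first exact: tangent_add.
by apply: (smoothD (sX f sf) (sY f sf)).
Qed.

Lemma smooth_field_scale h X : smooth h -> smooth_field X ->
  smooth_field (field_scale h X).
Proof.
move=> sh [tX sX]; split=> [p|f sf]; first exact: tangent_scale.
exact: (smoothM sh (sX f sf)).
Qed.

Lemma smooth_field0 : smooth_field (0 : field M).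
Proof. by split=> [p|f sf]; [exact: tangent0|exact: smooth_cst]. Qed.

Lemma smooth_field_cst (a : R) X : smooth_field X -> smooth_field (field_scale (fun=> a) X).
Proof. by apply: smooth_field_scale; exact: smooth_cst. Qed.

Lemma smooth_fieldB X Y : smooth_field X -> smooth_field Y -> smooth_field (X - Y).
Proof.
move=> sX sY; have -> : X - Y = X + field_scale (fun=> -1) Y.
  by apply/funext => p; rewrite -[RHS]/(X p + -1 *: Y p) scaleN1r.
by apply: smooth_fieldD => //; exact: smooth_field_cst.
Qed.

Lemma field_tangent X p : smooth_field X -> tangent p (X p).
Proof. by case=> h _; exact: h. Qed.

Lemma field_app_smooth X h : smooth_field X -> smooth h -> smooth (field_app X h).
Proof. by move=> [_ H]; exact: H. Qed.

Lemma fieldM X h k p : smooth_field X -> smooth h -> smooth k ->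
  X p (fun q => h q * k q) = h p * X p k + k p * X p h.
Proof. by move=> sX; exact: tangentM (field_tangent p sX). Qed.

Lemma fieldD X h k p : smooth_field X -> smooth h -> smooth k ->
  X p (fun q => h q + k q) = X p h + X p k.
Proof. by move=> sX; exact: tangentD (field_tangent p sX). Qed.

(** A chart around p with a bump function supported well inside it: the data
    that turn the coordinates, and the partial derivatives, into smooth
    functions and vector fields defined on all of M. *)
Record frame (p : M) := Frame {
  frame_chart : chart R M n ;
  frame_radius : R ;
  frame_bump : 'rV[R]_n -> R ;
  frame_atlas : atlas frame_chart ;
  frame_dom : chart_dom frame_chart p ;
  frame_radius_gt0 : 0 < frame_radius ;
  frame_sub : ball (chart_map frame_chart p) frame_radius `<=` chart_cod frame_chart ;
  frame_bump_smooth : forall k, Ck k setT frame_bump ;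
  frame_bump1 : frame_bump (chart_map frame_chart p) = 1 ;
  frame_bump_supp : forall x, frame_bump x != 0 ->
    ball (chart_map frame_chart p) (frame_radius / 2) x }.

Lemma frame_exists p : exists F : frame p, True.
Proof.
have [c ac dp] := atlas_cover p.
have /nbhs_ballP[r /= r0 sub] : nbhs (chart_map c p) (chart_cod c).
  by apply: open_nbhs_nbhs; split; [exact: chart_cod_open|exact: chart_map_cod].
have [|b [sb b1 bs]] := @bump_exists R n (chart_map c p) (r / 2).
  by rewrite divr_gt0.
by exists (@Frame p c r b ac dp r0 sub sb b1 bs).
Qed.

Section Frame.
Variables (p : M) (F : frame p).
Let c := frame_chart F.
Let r := frame_radius F.
Let b := frame_bump F.
Let a := chart_map c p.
Let ac : atlas c := frame_atlas F.
Let r2 : r / 2 < r.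
Proof. by have := frame_radius_gt0 F; rewrite -/r; lra. Qed.
Let r0 : 0 < r := frame_radius_gt0 F.

Lemma smooth_on_bump (O : set 'rV[R]_n) : smooth_on O b.
Proof. by move=> k; apply: Ck_sub (frame_bump_smooth F k). Qed.

Lemma bump_mul_smooth psi : smooth_on (ball a r) psi ->
  smooth_on setT (fun x => b x * psi x).
Proof.
move=> spsi k; apply: Ck_local => x _.
case: (pselect (ball a r x)) => bx.
  exists (ball a r) => //; apply: Ck_mul; [exact: ball_open|exact: smooth_on_bump|exact: spsi].
pose K := [set v : 'rV[R]_n | forall j, `[a 0 j - r / 2, a 0 j + r / 2]%classic (v 0 j)].
have cK : closed K.
  apply: compact_closed; last exact: compact_box.
  exact: norm_hausdorff.
have oK := closed_openC cK.
exists (~` K).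
  move=> Kx; apply: bx; apply/rV_ballP; split=> // j; apply: le_lt_trans r2.
  have := Kx j; rewrite /= in_itv /= ler_norml => /andP[h1 h2].
  by apply/andP; split; lra.
apply: (Ck_ext oK) (Ck_cst k 0 oK) => y /set_mem Ky /=.
have [->|/(frame_bump_supp (f := F))/rV_ballP[_ bY]] := eqVneq (b y) 0; first by rewrite mul0r.
have {}bY j : `|a 0 j - y 0 j| < r / 2 by exact: bY.
exfalso; apply: Ky => j; rewrite /= in_itv /=; have := bY j.
by rewrite ltr_norml => /andP[h1 h2]; apply/andP; split; lra.
Qed.

Lemma smooth_bump_extend psi : smooth_on (ball a r) psi ->
  smooth (extend c (fun x => b x * psi x)).
Proof.
move=> spsi; apply: (@smooth_extend _ _ _ c _ a (r / 2) r) => //.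
- exact: frame_sub.
- move=> x; rewrite mulf_eq0 negb_or => /andP[bx _]; exact: frame_bump_supp.
- by move=> k; apply: Ck_sub (bump_mul_smooth spsi k).
Qed.

(** The field b d/dx_i, extended by 0.  It is only a frame where the bump b does
    not vanish, in particular near p. *)
Definition frame_field (i : 'I_n) : field M := fun q f =>
  if `[< smooth f >] then extend c (fun x => b x * 'D_(e_ i) (f \o chart_inv c) x) q
  else 0.

Lemma smooth_on_chart f : smooth f -> smooth_on (ball a r) (f \o chart_inv c).
Proof. by move=> sf k; apply: Ck_sub (sf c ac k); exact: frame_sub. Qed.

Lemma smooth_on_partial (O : set 'rV[R]_n) (psi : 'rV[R]_n -> R) (i : 'I_n) :
  smooth_on O psi -> smooth_on O ('D_(e_ i) psi).
Proof. by move=> sp k; have [_ /(_ i)[]] := sp k.+1. Qed.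

Lemma frame_fieldE i f q : smooth f -> chart_dom c q ->
  frame_field i q f = b (chart_map c q) * 'D_(e_ i) (f \o chart_inv c) (chart_map c q).
Proof.
by move=> sf dq; rewrite /frame_field /extend (asboolT sf) mem_set.
Qed.

Lemma frame_field_inv i f x : smooth f -> chart_cod c x ->
  frame_field i (chart_inv c x) f = b x * 'D_(e_ i) (f \o chart_inv c) x.
Proof.
by move=> sf cx; rewrite frame_fieldE ?chart_invK //; exact: chart_inv_dom.
Qed.

Lemma frame_field_smooth i : smooth_field (frame_field i).
Proof.
split=> [q|f sf]; last first.
  have -> : field_app (frame_field i) f = extend c (fun x => b x * 'D_(e_ i) (f \o chart_inv c) x).
    by apply/funext => q; rewrite /field_app /frame_field (asboolT sf).
  by apply: smooth_bump_extend; apply: smooth_on_partial; exact: smooth_on_chart.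
have off f : q \notin chart_dom c -> frame_field i q f = 0.
  by move=> /negbTE nq; rewrite /frame_field /extend nq; case: ifP.
have der f : smooth f -> chart_dom c q ->
    derivable (f \o chart_inv c) (chart_map c q) (e_ i).
  by move=> sf dq; have [_ /(_ i)[d _]] := sf c ac 1%N; apply: d; exact: chart_map_cod.
split=> [t f h sf sh|f h sf sh|f nf]; last first.
- by rewrite /frame_field asboolF.
- have [/set_mem dq|/off nq] := boolP (q \in chart_dom c); last first.
    by rewrite !nq; ring.
  have smul := smoothM sf sh.
  rewrite !frame_fieldE //.
  rewrite -[X in 'D__ X _]/((f \o chart_inv c) * (h \o chart_inv c)).
  rewrite deriveM; [|exact: der|exact: der].
  rewrite /GRing.scale /= chart_mapK //; ring.
- have [/set_mem dq|/off nq] := boolP (q \in chart_dom c); last first.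
    by rewrite !nq; ring.
  have slin := smoothD (smoothM (@smooth_cst R n M t) sf) sh.
  rewrite !frame_fieldE //.
  rewrite -[X in 'D__ X _]/(t \*: (f \o chart_inv c) + (h \o chart_inv c)).
  rewrite deriveD; [|by apply: derivableZ; exact: der|exact: der].
  rewrite deriveZ; last exact: der.
  rewrite /GRing.scale /=; ring.
Qed.

Lemma frame_field_tangent i q : tangent q (frame_field i q).
Proof. by have [] := frame_field_smooth i. Qed.

Definition frame_coord (j : 'I_n) : M -> R := extend c (fun x => b x * (x 0 j - a 0 j)).

Lemma frame_coord_smooth j : smooth (frame_coord j).
Proof.
apply: smooth_bump_extend => k; apply: Ck_add; first exact: ball_open.
  by apply: Ck_coord; exact: ball_open.
by apply: Ck_cst; exact: ball_open.
Qed.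

Lemma frame_coord0 j : frame_coord j p = 0.
Proof. by rewrite /frame_coord /extend; case: ifP => // _; rewrite subrr mulr0. Qed.

Definition frame_cutoff : M -> R := extend c (fun x => b x * 1).

Lemma frame_cutoff_smooth : smooth frame_cutoff.
Proof.
by apply: smooth_bump_extend => k; apply: Ck_cst; exact: ball_open.
Qed.

Lemma frame_cutoff1 : frame_cutoff p = 1.
Proof.
rewrite /frame_cutoff /extend mem_set; last exact: frame_dom.
by rewrite mulr1; exact: frame_bump1.
Qed.

(** Multiplying h by a cutoff does not change v h, by the Leibniz rule. *)
Lemma tangent_localize v h : tangent p v -> smooth h -> h p = 0 ->
  v (fun q => frame_cutoff q * h q) = v h.
Proof.
move=> tv sh h0; rewrite (tangentM tv frame_cutoff_smooth sh) h0 mul0r addr0.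
by rewrite frame_cutoff1 mul1r.
Qed.

(** Hadamard's lemma writes f - f p as a sum of (x_j - a_j) H_j near p, and two
    factors of the cutoff make this an identity between smooth functions on M;
    the Leibniz rule at p then leaves H_j(a) = d_j f (a). *)
Lemma tangent_coord v f : tangent p v -> smooth f ->
  v f = \sum_j v (frame_coord j) * 'D_(e_ j) (f \o chart_inv c) a.
Proof.
move=> tv sf; pose phi := f \o chart_inv c.
have sphi : smooth_on (ball a r) phi by exact: smooth_on_chart.
pose H (j : 'I_n) := ray_mean 0 predT a ('D_(e_ j) phi).
have sH j : smooth_on (ball a r) (H j).
  by move=> k; apply: Ck_ray_mean; exact: smooth_on_partial.
pose eH j := extend c (fun x => b x * H j x).
have seH j : smooth (eH j) by exact: smooth_bump_extend.
have dp : chart_dom c p by exact: frame_dom.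
have ap : chart_map c p = a by [].
have sh0 : smooth (fun q => f q - f p) by apply: smoothB => //; exact: smooth_cst.
have sh1 : smooth (fun q => frame_cutoff q * (f q - f p)).
  by apply: smoothM => //; exact: frame_cutoff_smooth.
have -> : v f = v (fun q => frame_cutoff q * (frame_cutoff q * (f q - f p))).
  rewrite tangent_localize ?subrr ?mulr0 // tangent_localize ?subrr //.
  by rewrite (tangentB tv sf (@smooth_cst R n M _)) (tangent_cst _ tv) subr0.
have -> : (fun q => frame_cutoff q * (frame_cutoff q * (f q - f p)))
        = (fun q => \sum_j frame_coord j q * eH j q).
  apply/funext => q; rewrite /frame_cutoff /frame_coord /eH /extend; case: ifP => [/set_mem dq|_].
    have [b0|b0] := eqVneq (b (chart_map c q)) 0.
      by rewrite b0 !mul0r big1 // => j _; rewrite !mul0r.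
    have bq : ball a r (chart_map c q).
      by have := frame_bump_supp b0; apply: le_ball; exact: ltW.
    have := hadamard predT sphi bq.
    have -> : shrink predT a 0 (chart_map c q) = a.
      by apply/rowP => j; rewrite mxE mul0r addr0.
    rewrite /phi /= chart_mapK // /a chart_mapK // => ->.
    rewrite addrAC subrr add0r !mulr1 !mulr_sumr; apply: eq_bigr => j _.
    rewrite -/phi -/a /H; ring.
  by rewrite mul0r big1 // => j _; rewrite mul0r.
rewrite (tangent_sum _ tv); last by move=> j; apply: smoothM => //; exact: frame_coord_smooth.
apply: eq_bigr => j _.
rewrite (tangentM tv (frame_coord_smooth j) (seH j)) frame_coord0 mul0r add0r mulrC; congr (_ * _).
rewrite /eH /extend mem_set // -/a /b frame_bump1 mul1r /H /ray_mean.
have shr t : shrink predT a t a = a.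
  by apply/rowP => i; rewrite mxE subrr mulr0 addr0.
rewrite -[RHS](int01_cst ('D_(e_ j) phi a)); apply: int01_ext => t _.
by rewrite expr0 mul1r shr.
Qed.

Lemma frame_field_p i f : smooth f -> frame_field i p f = 'D_(e_ i) (f \o chart_inv c) a.
Proof.
by move=> sf; rewrite frame_fieldE //; [rewrite /b frame_bump1 mul1r|exact: frame_dom].
Qed.

Lemma tangent_decomp v : tangent p v -> v = \sum_j v (frame_coord j) *: frame_field j p.
Proof.
move=> tv.
have ev f : (\sum_j v (frame_coord j) *: frame_field j p : functional M) f
    = \sum_j v (frame_coord j) * frame_field j p f.
  by elim/big_ind2: _ => // x1 x2 y1 y2 h1 h2; rewrite -h1 -h2.
apply/funext => f; rewrite ev; case: (pselect (smooth f)) => sf.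
  by rewrite (tangent_coord tv sf); apply: eq_bigr => j _; rewrite frame_field_p.
have [_ _ n0] := tv; rewrite n0 // big1 // => j _.
by have [_ _ n1] := frame_field_tangent j p; rewrite n1 // mulr0.
Qed.

Lemma frame_field_coord i j : frame_field i p (frame_coord j) = (j == i)%:R.
Proof.
rewrite frame_field_p; last exact: frame_coord_smooth.
have near_b : \forall x \near a, b x * (x 0 j - a 0 j) = (frame_coord j \o chart_inv c) x.
  have : \forall x \near a, chart_cod c x.
    by apply: open_nbhs_nbhs; split; [exact: chart_cod_open|exact: chart_map_cod (frame_dom F)].
  apply: filterS => x cx; rewrite /= /frame_coord /extend mem_set ?chart_invK //.
  exact: chart_inv_dom.
rewrite -(near_eq_derive _ near_b).
have db : derivable b a (e_ i) by have [_ /(_ i)[+ _]] := frame_bump_smooth F 1; apply.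
have dc : is_derive a (e_ i) (fun x : 'rV[R]_n => x 0 j - a 0 j) ((e_ i : 'rV[R]_n) 0 j).
  have := is_deriveB (is_derive_coord j a (e_ i)) (is_derive_cst (a 0 j) a (e_ i)).
  by move/is_derive_eq; apply; rewrite subr0.
have := is_deriveM (derivableP db) dc; move=> [_ ->].
by rewrite subrr /GRing.scale /= mul0r addr0 /b frame_bump1 mul1r mxE eqxx.
Qed.

Lemma frame_field_neq0 i : frame_field i p <> 0.
Proof.
move=> /(congr1 (fun v : functional M => v (frame_coord i))).
by rewrite frame_field_coord eqxx => /eqP; rewrite oner_eq0.
Qed.

(** Vector fields are local operators. *)
Lemma frame_field_near0 i h : smooth h -> (\forall q \near p, h q = 0) ->
  frame_field i p h = 0.
Proof.
move=> sh nh; rewrite frame_field_p //.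
have E : \forall x \near chart_map (c) p,
    (h \o chart_inv (c)) x = cst 0 x.
  exact: (near_chart (frame_dom F) nh).
by rewrite (near_eq_derive _ E) derive_cst.
Qed.

(** The frame with constant coefficients extends v. *)
Lemma tangent_extend v : tangent p v -> exists2 X, smooth_field X & X p = v.
Proof.
move=> tv; exists (\sum_j field_scale (fun=> v (frame_coord j)) (frame_field j)).
  elim/big_ind: _ => [|X Y|j _]; [exact: smooth_field0|exact: smooth_fieldD|].
  by apply: smooth_field_cst; exact: frame_field_smooth.
rewrite [RHS](tangent_decomp tv).
by elim/big_ind2: _ => // x1 x2 y1 y2 h1 h2; rewrite -h1 -h2.
Qed.

End Frame.
End Tangent.

(** * Riemannian metrics *)

Section Metric.
Context (R : realType) (n : nat) (M : manifold R n).
Variables (g : M -> functional M -> functional M -> R).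
Hypothesis hg : riemannian_metric g.
Implicit Types (p : M) (v w : functional M) (X Y : field M).

Lemma metricC p v w : tangent p v -> tangent p w -> g p v w = g p w v.
Proof. by have [_ + _ _] := hg; apply. Qed.

Lemma metricDl p v v' w : tangent p v -> tangent p v' -> tangent p w ->
  g p (v + v') w = g p v w + g p v' w.
Proof.
have [h _ _ _] := hg => tv tv' tw.
by rewrite -[v in LHS]scale1r h // mul1r.
Qed.

Lemma metric0l p w : tangent p w -> g p 0 w = 0.
Proof.
move=> tw; have t0 := tangent0 p; have := metricDl t0 t0 tw.
by rewrite addr0 => /eqP; rewrite -subr_eq0 opprD addNKr oppr_eq0 => /eqP.
Qed.

Lemma metricZl p a v w : tangent p v -> tangent p w -> g p (a *: v) w = a * g p v w.
Proof.
have [h _ _ _] := hg => tv tw; have t0 := tangent0 p.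
by rewrite -[a *: v]addr0 h // metric0l // addr0.
Qed.

Lemma metricBl p v v' w : tangent p v -> tangent p v' -> tangent p w ->
  g p (v - v') w = g p v w - g p v' w.
Proof.
move=> tv tv' tw; rewrite -scaleN1r metricDl ?metricZl ?mulN1r //.
exact: tangent_scale.
Qed.

Lemma tangent_sub p v w : tangent p v -> tangent p w -> tangent p (v - w).
Proof.
by move=> tv tw; rewrite -scaleN1r; apply: tangent_add => //; exact: tangent_scale.
Qed.

Lemma metricDr p v w w' : tangent p v -> tangent p w -> tangent p w' ->
  g p v (w + w') = g p v w + g p v w'.
Proof.
move=> tv tw tw'; have tD := tangent_add tw tw'.
by rewrite metricC // metricDl // [g p w v]metricC // [g p w' v]metricC.
Qed.

Lemma metricZr p a v w : tangent p v -> tangent p w -> g p v (a *: w) = a * g p v w.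
Proof.
move=> tv tw; have tZ := tangent_scale a tw.
by rewrite metricC // metricZl // [g p w v]metricC.
Qed.

Lemma metric_gt0 p v : tangent p v -> v <> 0 -> 0 < g p v v.
Proof. by have [_ _ + _] := hg; apply. Qed.

Lemma metric_eq0 p v : tangent p v -> g p v v = 0 -> v = 0.
Proof.
move=> tv gv; apply: contrapT => /(metric_gt0 tv).
by rewrite gv ltxx.
Qed.

Lemma metric_ge0 p v : tangent p v -> 0 <= g p v v.
Proof.
move=> tv; case: (pselect (v = 0)) => [->|/(metric_gt0 tv)/ltW //].
by rewrite metric0l //; exact: tangent0.
Qed.

Lemma cauchy_schwarz p v w : tangent p v -> tangent p w ->
  g p v w ^+ 2 <= g p v v * g p w w.
Proof.
move=> tv tw; case: (pselect (w = 0)) => [->|w0].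
  have t0 := tangent0 p.
  by rewrite metricC // metric0l // expr0n /= metric0l // mulr0.
have gw := metric_gt0 tw w0.
have tgv := tangent_scale (g p w w) tv; have tgw := tangent_scale (- g p v w) tw.
have := metric_ge0 (tangent_add tgv tgw).
have tD := tangent_add tgv tgw.
rewrite metricDl // !metricDr // !metricZl // !metricZr // [g p w v]metricC // => h.
have {}h : 0 <= g p w w * (g p v v * g p w w - g p v w ^+ 2).
  apply: le_trans h _; rewrite le_eqVlt; apply/orP; left; apply/eqP; ring.
by move: h; rewrite pmulr_rge0 // subr_ge0.
Qed.

Definition inner X Y : M -> R := fun p => g p (X p) (Y p).

Lemma inner_smooth X Y : smooth_field X -> smooth_field Y -> smooth (inner X Y).
Proof. by have [_ _ _ h] := hg; exact: h. Qed.

Lemma metric_sumr p v (c : 'I_n -> R) (w : 'I_n -> functional M) : tangent p v ->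
  (forall i, tangent p (w i)) ->
  tangent p (\sum_i c i *: w i) /\ g p v (\sum_i c i *: w i) = \sum_i c i * g p v (w i).
Proof.
move=> tv tw; elim/big_ind2: _ => [|w1 x1 w2 x2 [t1 <-] [t2 <-]|i _].
- by split; [exact: tangent0|rewrite metricC // ?metric0l //; exact: tangent0].
- by split; [exact: tangent_add|exact: metricDr].
- by split; [exact: tangent_scale|exact: metricZr].
Qed.

(** A null combination for the Gram matrix is the coefficient vector of a tangent
    vector of norm 0, and the coordinates read off its coefficients. *)
Lemma gram_free p (F : frame p) (c : 'I_n -> R) :
  (forall j, \sum_i c i * inner (frame_field F j) (frame_field F i) p = 0) -> forall j, c j = 0.
Proof.
move=> h j; pose w : functional M := \sum_i c i *: frame_field F i p.
have tF i : tangent p (frame_field F i p) by exact: frame_field_tangent.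
have tw : tangent p w by have [] := metric_sumr c (tF j) tF.
have gw i : g p (frame_field F i p) w = 0 by have [_ ->] := metric_sumr c (tF i) tF; exact: h.
have w0 : w = 0.
  apply: (metric_eq0 tw); have [_ ->] := metric_sumr c tw tF.
  by rewrite big1 // => i _; rewrite metricC // gw mulr0.
have : w (frame_coord F j) = 0 by rewrite w0.
have -> : w (frame_coord F j) = \sum_i c i * frame_field F i p (frame_coord F j).
  by rewrite /w; elim/big_ind2: _ => // x1 x2 y1 y2 <- <-.
rewrite (bigD1 j) //= frame_field_coord eqxx mulr1 big1 ?addr0 // => i ij.
by rewrite frame_field_coord eq_sym (negbTE ij) mulr0.
Qed.

End Metric.

(** * Concircular vector fields *)

Section Concircular.
Context (R : realType) (n : nat) (M : manifold R n).
Variables (g : M -> functional M -> functional M -> R)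
  (nabla : field M -> field M -> field M) (u : field M) (f : M -> R).
Hypotheses (hg : riemannian_metric g) (hnabla : levi_civita g nabla)
  (hu : concircular nabla u f).
Implicit Types (p q : M) (X Y W : field M).

Let N : M -> R := inner g u u.

Let su : smooth_field u. Proof. by have [] := hu. Qed.
Let sf : smooth f. Proof. by have [] := hu. Qed.
Let nabla_u X : smooth_field X -> nabla X u = field_scale f X.
Proof. by have [_ _] := hu; apply. Qed.
Let sN : smooth N. Proof. exact: inner_smooth. Qed.

Lemma nabla_smooth X Y : smooth_field X -> smooth_field Y -> smooth_field (nabla X Y).
Proof. by have [[h _ _ _] _ _] := hnabla; exact: h. Qed.

Lemma deriv_inner X Y Z : smooth_field X -> smooth_field Y -> smooth_field Z ->
  field_app X (inner g Y Z)
    = (fun p => inner g (nabla X Y) Z p + inner g Y (nabla X Z) p).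
Proof. by have [_ _ h] := hnabla; exact: h. Qed.

Lemma deriv_inner_u X Y : smooth_field X -> smooth_field Y ->
  field_app X (inner g Y u)
    = (fun p => inner g (nabla X Y) u p + f p * inner g X Y p).
Proof.
move=> sX sY; rewrite deriv_inner //; apply/funext => p; congr (_ + _).
rewrite /inner nabla_u // /field_scale metricZr //; try exact: field_tangent.
by congr (_ * _); apply: metricC => //; exact: field_tangent.
Qed.

Lemma deriv_normsq X : smooth_field X ->
  field_app X N = (fun p => 2 * (f p * inner g X u p)).
Proof.
move=> sX; rewrite /N deriv_inner //; apply/funext => p.
rewrite /inner nabla_u // /field_scale metricZr ?metricZl //;
  try exact: field_tangent.
rewrite (metricC hg (field_tangent p su) (field_tangent p sX)).
by rewrite mulrDl mul1r.
Qed.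

Lemma lie_app X Y h p : smooth_field X -> smooth_field Y ->
  (nabla X Y - nabla Y X) p h = X p (field_app Y h) - Y p (field_app X h).
Proof. by have [_ tf _] := hnabla => sX sY; rewrite tf. Qed.

(** The bracket [X,Y] = nabla_X Y - nabla_Y X applied to N can be computed in
    two ways: as X Y - Y X, and through [deriv_normsq].  The second derivatives
    cancel and leave the claim. *)
Lemma differential_parallel X Y p : smooth_field X -> smooth_field Y ->
  X p f * inner g Y u p = Y p f * inner g X u p.
Proof.
move=> sX sY.
have sL := smooth_fieldB (nabla_smooth sX sY) (nabla_smooth sY sX).
have second Z W : smooth_field Z -> smooth_field W ->
  Z p (field_app W N) = 2 * (Z p f * inner g W u p
     + f p * (inner g (nabla Z W) u p + f p * inner g Z W p)).
  move=> sZ sW; rewrite deriv_normsq //.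
  have sWu : smooth (inner g W u) by exact: inner_smooth.
  rewrite (tangentZ 2 (field_tangent p sZ) (smoothM sf sWu)).
  rewrite fieldM // -[Z p (inner g W u)]/(field_app Z (inner g W u) p).
  rewrite deriv_inner_u //; ring.
have := lie_app N p sX sY; rewrite !second //.
rewrite -[LHS]/(field_app (nabla X Y - nabla Y X) N p) deriv_normsq //.
rewrite -[inner g (nabla X Y - nabla Y X) u p]/(g p (nabla X Y p - nabla Y X p) (u p)).
rewrite metricBl //; try exact: field_tangent; try exact: nabla_smooth;
  try (apply: field_tangent; exact: nabla_smooth).
rewrite -[g p (nabla X Y p) _]/(inner g (nabla X Y) u p).
rewrite -[g p (nabla Y X p) _]/(inner g (nabla Y X) u p).
have -> : inner g Y X p = inner g X Y p.
  by apply: metricC => //; exact: field_tangent.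
lra.
Qed.

(** Compares the two expressions of [X,Y] applied to g(W,u).  The left-hand side
    is g(R(X,Y)u, W), and the point is that the right-hand side is linear in u
    and f with smooth coefficients. *)
Lemma curvature_identity X Y W : smooth_field X -> smooth_field Y -> smooth_field W ->
  exists Q K, [/\ smooth_field Q, smooth K & forall p,
    X p f * inner g Y W p - Y p f * inner g X W p = inner g Q u p + f p * K p].
Proof.
move=> sX sY sW; pose L := nabla X Y - nabla Y X.
have sL : smooth_field L.
  exact: smooth_fieldB (nabla_smooth sX sY) (nabla_smooth sY sX).
have sXW := nabla_smooth sX sW; have sYW := nabla_smooth sY sW.
have sYXW := nabla_smooth sY sXW; have sXYW := nabla_smooth sX sYW.
have sLW := nabla_smooth sL sW.
have second Z V p : smooth_field Z -> smooth_field V ->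
  Z p (field_app V (inner g W u)) = inner g (nabla Z (nabla V W)) u p
    + f p * inner g Z (nabla V W) p + (f p * field_app Z (inner g V W) p
    + inner g V W p * Z p f).
  move=> sZ sV; rewrite deriv_inner_u //.
  have sVW := nabla_smooth sV sW.
  have s1 : smooth (inner g (nabla V W) u) by exact: inner_smooth.
  have s2 : smooth (inner g V W) by exact: inner_smooth.
  rewrite (fieldD _ sZ s1 (smoothM sf s2)) fieldM //.
  rewrite -[Z p (inner g (nabla V W) u)]/(field_app Z (inner g (nabla V W) u) p).
  by rewrite deriv_inner_u.
exists (nabla L W + (nabla Y (nabla X W) - nabla X (nabla Y W))).
exists (fun p => (inner g L W p + field_app Y (inner g X W) p + inner g Y (nabla X W) p)
   - (field_app X (inner g Y W) p + inner g X (nabla Y W) p)).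
split.
- by apply: smooth_fieldD => //; exact: smooth_fieldB.
- by apply: smoothB; repeat apply: smoothD; first [exact: inner_smooth|
    apply: field_app_smooth => //; exact: inner_smooth].
move=> p; have := lie_app (inner g W u) p sX sY.
rewrite !second // -/L -[L p _]/(field_app L (inner g W u) p) deriv_inner_u //.
have tp Z : smooth_field Z -> tangent p (Z p) by exact: field_tangent.
rewrite -[inner g (_ + (_ - _)) u p]/(g p (nabla L W p
   + (nabla Y (nabla X W) p - nabla X (nabla Y W) p)) (u p)).
rewrite metricDl ?metricBl //; try (exact: tp); last by apply: tangent_sub; exact: tp.
rewrite -[g p (nabla L W p) (u p)]/(inner g (nabla L W) u p).
rewrite -[g p (nabla Y _ p) (u p)]/(inner g (nabla Y (nabla X W)) u p).
rewrite -[g p (nabla X _ p) (u p)]/(inner g (nabla X (nabla Y W)) u p).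
by move=> h; lra.
Qed.

Hypotheses (hn : (1 < n)%N) (hM : connected [set: M]) (hf : exists p : M, f p <> 0).

(** Vanishes exactly at the common zeros of u and f. *)
Let H : M -> R := fun p => N p + f p * f p.

Let sH : smooth H. Proof. by apply: smoothD => //; exact: smoothM. Qed.

Lemma normsq_ge0 p : 0 <= N p.
Proof. by apply: metric_ge0 => //; exact: field_tangent. Qed.

Let H_ge0 p : 0 <= H p.
Proof. by rewrite addr_ge0 ?normsq_ge0 // -expr2 sqr_ge0. Qed.

Lemma inner_bound X p : smooth_field X ->
  2 * `|f p * inner g X u p| <= (1 + inner g X X p) * H p.
Proof.
move=> sX; have tX := field_tangent p sX; have tu := field_tangent p su.
have cs : inner g X u p ^+ 2 <= inner g X X p * N p by exact: cauchy_schwarz.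
have N0 := normsq_ge0 p; have X0 : 0 <= inner g X X p by exact: metric_ge0.
have f0 : 0 <= f p * f p by rewrite -expr2 sqr_ge0.
have : 2 * `|f p * inner g X u p| <= f p ^+ 2 + inner g X u p ^+ 2.
  rewrite normrM -(real_normK (num_real (f p))) -(real_normK (num_real (inner g X u p))).
  have := sqr_ge0 (`|f p| - `|inner g X u p|); rewrite sqrrB -mulr_natl => h; lra.
move=> h; apply: le_trans h _; rewrite /H.
have : 0 <= inner g X X p * (f p * f p) by exact: mulr_ge0.
by rewrite expr2; lra.
Qed.

(** The function h shows that X and Z are linearly independent at p.
    Replacing Z by a field Y orthogonal to X, the curvature identity with W = Y
    reads g(Y,Y) X(f) = g(Q,u) + f K, and X(H) = 2 f g(X,u) + 2 f X(f) is then
    bounded by H through Cauchy-Schwarz. *)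
Lemma transverse_gradient_bound X Z p h : smooth_field X -> smooth_field Z ->
  X p <> 0 -> X p h = 0 -> Z p h = 1 ->
  exists C, \forall q \near p, `|X q H| <= C * H q.
Proof.
move=> sX sZ Xp0 Xh Zh.
pose Y : field M := field_scale (inner g X X) Z - field_scale (inner g Z X) X.
have sY : smooth_field Y.
  by apply: smooth_fieldB; apply: smooth_field_scale => //; exact: inner_smooth.
have tX q : tangent q (X q) by exact: field_tangent.
have tY q : tangent q (Y q) by exact: field_tangent.
have tZ q : tangent q (Z q) by exact: field_tangent.
have orth q : inner g Y X q = 0.
  rewrite -[inner g Y X q]/(g q (inner g X X q *: Z q - inner g Z X q *: X q) (X q)).
  have t1 := tangent_scale (inner g X X q) (tZ q).
  have t2 := tangent_scale (inner g Z X q) (tX q).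
  rewrite (metricBl hg t1 t2 (tX q)) (metricZl hg _ (tZ q) (tX q)).
  by rewrite (metricZl hg _ (tX q) (tX q)) mulrC subrr.
have Yp0 : Y p <> 0.
  move=> /(congr1 (fun v : functional M => v h)).
  rewrite -[LHS]/(inner g X X p * Z p h - inner g Z X p * X p h).
  by rewrite Xh Zh mulr0 subr0 mulr1 => /(metric_eq0 hg (tX p)).
pose D := inner g Y Y; have sD : smooth D by exact: inner_smooth.
have Dp : 0 < D p by exact: metric_gt0.
have [Q [K [sQ sK curv]]] := curvature_identity sX sY sY.
have XH q : X q H = 2 * (f q * inner g X u q) + 2 * (f q * X q f).
  rewrite (fieldD _ sX sN (smoothM sf sf)) fieldM //.
  rewrite -[X q N]/(field_app X N q) deriv_normsq //; ring.
have DXf q : D q * X q f = inner g Q u q + f q * K q.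
  have orth' : inner g X Y q = 0 by rewrite -(orth q); exact: metricC.
  by have := curv q; rewrite orth' mulr0 subr0 mulrC.
pose E q := D q * (1 + inner g X X q) + (1 + inner g Q Q q) + (1 + K q * K q).
have sE : smooth E.
  apply: smoothD; [apply: smoothD|].
  - apply: smoothM => //; apply: smoothD; [exact: smooth_cst|exact: inner_smooth].
  - by apply: smoothD; [exact: smooth_cst|exact: inner_smooth].
  - by apply: smoothD; [exact: smooth_cst|exact: smoothM].
have D0 q : 0 <= D q by exact: metric_ge0.
have bound q : D q * `|X q H| <= E q * H q.
  have -> : D q * `|X q H| = `|D q * X q H| by rewrite normrM (ger0_norm (D0 q)).
  have -> : D q * X q H = D q * (2 * (f q * inner g X u q))
      + (2 * (f q * inner g Q u q) + 2 * (f q * f q) * K q).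
    have -> : D q * X q H = D q * (2 * (f q * inner g X u q)) + 2 * f q * (D q * X q f).
      by rewrite XH; ring.
    by rewrite DXf; ring.
  have bX := inner_bound q sX; have bQ := inner_bound q sQ.
  apply: le_trans (ler_normD _ _) _; rewrite /E [leRHS]mulrDl [X in _ <= X + _]mulrDl -[leRHS]addrA.
  apply: lerD; last (apply: le_trans (ler_normD _ _) _; apply: lerD).
  - rewrite normrM (ger0_norm (D0 q)) -mulrA ler_wpM2l // normrM.
    by rewrite (@ger0_norm _ 2).
  - by rewrite normrM (@ger0_norm _ 2).
  - rewrite !normrM (@ger0_norm _ 2) //.
    have kk : 2 * `|K q| <= 1 + K q * K q.
      rewrite -expr2 -(real_normK (num_real (K q))).
      have := sqr_ge0 (1 - `|K q|); rewrite sqrrB expr1n mul1r -mulr_natl => hK; lra.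
    have f0 : 0 <= `|f q| * `|f q| by rewrite mulr_ge0.
    have fH : `|f q| * `|f q| <= H q.
      by rewrite -normrM ger0_norm -?expr2 ?sqr_ge0 // /H lerDr normsq_ge0.
    apply: (@le_trans _ _ ((1 + K q * K q) * (`|f q| * `|f q|))).
      by rewrite mulrAC; apply: ler_wpM2r.
    by apply: ler_wpM2l => //; rewrite -expr2 addr_ge0 ?sqr_ge0.
exists ((E p + 1) / (D p / 2)).
have nE : \forall q \near p, E q < E p + 1.
  by apply: (cvgr_lt (E p)); [exact: smooth_continuous|rewrite ltrDl].
have nD : \forall q \near p, D p / 2 < D q.
  by apply: (cvgr_gt (D p)); [exact: smooth_continuous|lra].
apply: (@filterS2 _ (nbhs p) _ _ _ _ _ nE nD) => q Eq Dq.
have Dp2 : 0 < D p / 2 by lra.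
rewrite mulrAC ler_pdivlMr // mulrC.
apply: (@le_trans _ _ (D q * `|X q H|)); first by rewrite ler_wpM2r // ltW.
by apply: le_trans (bound q) _; rewrite ler_wpM2r // ltW.
Qed.

(** In dimension at least 2 each frame field has an independent companion. *)
Lemma frame_field_gradient_bound p (F : frame p) (i : 'I_n) : exists C,
  \forall q \near p, `|frame_field F i q H| <= C * H q.
Proof.
have [j ji] : exists j : 'I_n, j != i.
  have [->|h] := eqVneq i (Ordinal (ltnW hn)); first by exists (Ordinal hn).
  by exists (Ordinal (ltnW hn)); rewrite eq_sym.
apply: (@transverse_gradient_bound _ (frame_field F j) p (frame_coord F j)).
- exact: frame_field_smooth.
- exact: frame_field_smooth.
- exact: frame_field_neq0.
- by rewrite frame_field_coord (negbTE ji).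
- by rewrite frame_field_coord eqxx.
Qed.

(** The bounds on the frame fields bound the partial derivatives of H by H in a
    cube of the chart, where Gronwall's lemma applies. *)
Lemma common_zero_near p : H p = 0 -> \forall q \near p, H q = 0.
Proof.
move=> Hp; have [F _] := frame_exists p.
set c := frame_chart F; set a := chart_map c p.
have dp : chart_dom c p by exact: frame_dom.
have ac : atlas c by exact: frame_atlas.
have /choice[C hC] := frame_field_gradient_bound F.
pose eta := H \o chart_inv c.
have n1 : \forall x \near a, forall i : 'I_n,
    `|frame_field F i (chart_inv c x) H| <= C i * H (chart_inv c x).
  apply: (near_chart (P := fun q => forall i : 'I_n, `|frame_field F i q H| <= C i * H q) dp).
  exact: (@filter_forall M 'I_n (fun i q => `|frame_field F i q H| <= C i * H q) (nbhs p) _ hC).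
have n2 : \forall x \near a, 1 / 2 < frame_bump F x.
  apply: (@cvgr_gt _ _ (nbhs a) _ _ (frame_bump F a)).
    exact: Ck_continuous (frame_bump_smooth F 0) _.
  by rewrite frame_bump1; lra.
have n3 : \forall x \near a, chart_cod c x.
  by apply: open_nbhs_nbhs; split; [exact: chart_cod_open|exact: chart_map_cod].
have n4 : \forall x \near a, [/\ chart_cod c x, forall i : 'I_n,
    `|frame_field F i (chart_inv c x) H| <= C i * H (chart_inv c x) & 1 / 2 < frame_bump F x].
  by apply: (@filterS3 _ (nbhs a) _ _ _ _ _ _ n3 n1 n2).
have /nbhs_ballP[s /= s0 sub] := n4.
have oB : open (ball a s) by exact: ball_open.
have eta0 : forall x, ball a s x -> eta x = 0.
  apply: (@gronwall_ball R n a s (\sum_j 2 * `|C j|) eta oB).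
  - by apply: Ck_sub (sH ac 1) => x /sub[].
  - by move=> x; exact: H_ge0.
  - by rewrite /eta /= chart_mapK.
  move=> x i /sub[cx b1 b2]; have := b1 i; rewrite frame_field_inv // -/c -/eta.
  rewrite -[H (chart_inv c x)]/(eta x) normrM gtr0_norm; last by lra.
  move=> h; apply: (@le_trans _ _ (2 * `|C i| * eta x)); last first.
    apply: ler_wpM2r; first exact: H_ge0.
    rewrite (bigD1 i) //= lerDl sumr_ge0 // => j _; exact: mulr_ge0.
  have h2 : C i * eta x <= `|C i| * eta x.
    by apply: ler_wpM2r; [exact: H_ge0|exact: ler_norm].
  have h3 : 1 / 2 * `|'D_(e_ i) eta x| <= frame_bump F x * `|'D_(e_ i) eta x|.
    by apply: ler_wpM2r => //; exact: ltW.
  lra.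
have := near_chart_map dp (nbhsx_ballx a s s0).
apply: filterS => q [dq bq]; have := eta0 _ bq.
by rewrite /eta /= chart_mapK.
Qed.

(** By connectedness, a common zero would make H, hence f, vanish identically. *)
Lemma no_common_zero p : N p = 0 -> f p <> 0.
Proof.
move=> Np fp; have [q0 fq0] := hf; apply: fq0.
pose B : set M := [set q | H q = 0].
have ZH q : H q = 0 -> f q = 0.
  move=> /eqP; rewrite /H paddr_eq0 ?normsq_ge0 // -?expr2 ?sqr_ge0 //.
  by rewrite sqrf_eq0 => /andP[_ /eqP].
have -> : f q0 = 0 => //; apply: ZH; rewrite -[_ = _]/(B q0).
have -> // : B = setT; apply: hM.
- by exists p; rewrite /B /= /H Np fp mulr0 addr0.
- exists B; last by rewrite setTI.
  by rewrite openE => q /common_zero_near.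
- exists B; last by rewrite setTI.
  apply: (@preimage_closed _ _ H [set x | x = 0]) => [q _|]; last exact: closed_eq.
  exact: smooth_continuous.
Qed.

Lemma u_eq0 p : N p = 0 -> u p = 0.
Proof. by move=> /(metric_eq0 hg (field_tangent p su)). Qed.

(** If g(X,u) vanishes near p, its derivative along X is
    0 = g(nabla_X X, u) + f g(X,X) = f g(X,X) at p. *)
Lemma zeros_nowhere_dense p : ~ (\forall q \near p, N q = 0).
Proof.
move=> nN; have Np := nbhs_singleton nN; apply: (no_common_zero Np).
have [F _] := frame_exists p; pose X := frame_field F (Ordinal hn).
have sX : smooth_field X by exact: frame_field_smooth.
have tX q : tangent q (X q) by exact: field_tangent.
have Xu : \forall q \near p, inner g X u q = 0.
  apply: filterS nN => q /u_eq0 uq.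
  by rewrite /inner uq metricC // ?metric0l //; exact: tangent0.
have := @frame_field_near0 R n M p F (Ordinal hn) _ (inner_smooth hg sX su) Xu.
rewrite -[LHS]/(field_app X (inner g X u) p) deriv_inner_u //.
have -> : inner g (nabla X X) u p = 0.
  have t : tangent p (nabla X X p) by apply: field_tangent; exact: nabla_smooth.
  by rewrite /inner u_eq0 // metricC // ?metric0l //; exact: tangent0.
move/eqP; rewrite add0r mulf_eq0 => /orP[/eqP //|/eqP].
by move=> /(metric_eq0 hg (tX p)) /frame_field_neq0.
Qed.

(** How identities are extended from the set where u does not vanish. *)
Lemma dense_eq0 (h : M -> R) : smooth h -> (forall q, N q != 0 -> h q = 0) ->
  forall p, h p = 0.
Proof.
move=> sh h0 p; apply: contrapT => /eqP hp; apply: (@zeros_nowhere_dense p).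
have : \forall q \near p, h q != 0.
  have := smooth_continuous sh; move=> /(_ p) ch.
  exact: (ch [set y | y != 0] (open_nbhs_nbhs (conj (@open_neq R 0) hp))).
by apply: filterS => q; apply: contra_neqP => /eqP /h0.
Qed.

Let uf : M -> R := field_app u f.

Let s_uf : smooth uf. Proof. exact: field_app_smooth. Qed.

(** In a frame, d_j g(X_i,u) = f(p) g(X_j,X_i) at p, an invertible matrix
    because f(p) is not 0: [radial_division] applies to the components
    X_i(f) = rho g(X_i,u), with rho = u(f) / N. *)
Lemma quotient_at_zero p : N p = 0 -> exists c (V : set 'rV[R]_n) (sigma : 'rV[R]_n -> R),
  [/\ atlas c, chart_dom c p, open V, V (chart_map c p) & V `<=` chart_cod c] /\
  (smooth_on V sigma /\
   forall x, V x -> uf (chart_inv c x) = sigma x * N (chart_inv c x)).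
Proof.
move=> Np; have [F _] := frame_exists p.
set c := frame_chart F; set a := chart_map c p.
have dp : chart_dom c p by exact: frame_dom.
have ac : atlas c by exact: frame_atlas.
have sX i : smooth_field (frame_field F i) by exact: frame_field_smooth.
have sXu i : smooth (inner g (frame_field F i) u) by exact: inner_smooth.
pose alpha i := inner g (frame_field F i) u \o chart_inv c.
pose V i := field_app (frame_field F i) f \o chart_inv c.
have alpha0 i q : N q = 0 -> inner g (frame_field F i) u q = 0.
  move=> /u_eq0 uq; rewrite /inner uq metricC // ?metric0l //; try exact: tangent0;
  exact: frame_field_tangent.
have deta : \det (\matrix_(i, j) 'D_(e_ j) (alpha i) a) != 0.
  apply/det0P => -[v v0 /rowP vA]; case/eqP: v0; apply/rowP => j; rewrite mxE.
  move: j; apply: (gram_free hg (F := F)) => j; have := vA j; rewrite !mxE => E.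
  have [//|fp] : f p = 0 \/ f p <> 0 by case: (pselect (f p = 0)); [left|right].
    by move=> /(no_common_zero Np).
  move/eqP in fp; apply: (mulfI fp); rewrite mulr0 -[RHS]E mulr_sumr.
  apply: eq_bigr => i _; rewrite mxE mulrCA; congr (_ * _).
  rewrite -(frame_field_p F j (sXu i)) -[RHS]/(field_app (frame_field F j) (inner g (frame_field F i) u) p).
  rewrite deriv_inner_u // -[LHS]add0r; congr (_ + _).
  rewrite /inner u_eq0 // metricC // ?metric0l //; try exact: tangent0;
    by apply: field_tangent; exact: nabla_smooth.
pose rho x := uf (chart_inv c x) / N (chart_inv c x).
have rr := frame_radius_gt0 F.
have [] := @radial_division R n a (frame_radius F) alpha V rho hn rr.
- by move=> i; exact: smooth_on_chart.
- by move=> i; apply: smooth_on_chart; exact: field_app_smooth.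
- by move=> i; rewrite /alpha /= chart_mapK // alpha0.
- exact: deta.
- move=> x bx [i alx] j.
  have Nx : N (chart_inv c x) != 0.
    by apply/eqP => /alpha0 h; apply: alx; rewrite /alpha /= h.
  apply: (mulIf Nx); rewrite [RHS]mulrAC /rho divfK //.
  rewrite -[RHS]/(uf (chart_inv c x) * inner g (frame_field F j) u (chart_inv c x)).
  exact: (differential_parallel _ (sX j) su).
move=> r1 [sigma [r10 r1r ssigma Vs al]].
have sub : ball a r1 `<=` chart_cod c.
  by move=> x bx; apply: (frame_sub (f := F)); apply: le_ball bx.
exists c, (ball a r1), sigma; split.
  split=> //; [exact: ball_open|exact: ballxx].
split=> // x bx; have [->|xa] := eqVneq x a.
  rewrite /a chart_mapK // Np mulr0 /uf /field_app u_eq0 //.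
have [i alx] := al x bx xa; move/eqP in alx.
apply: (mulIf alx).
have := differential_parallel (chart_inv c x) (sX i) su.
rewrite -[X in X * _ = _]/(V i x) Vs // => <-.
by rewrite mulrAC.
Qed.

Lemma quotient_local p : exists c (V : set 'rV[R]_n) (sigma : 'rV[R]_n -> R),
  [/\ atlas c, chart_dom c p, open V, V (chart_map c p) & V `<=` chart_cod c] /\
  (smooth_on V sigma /\
   forall x, V x -> uf (chart_inv c x) = sigma x * N (chart_inv c x)).
Proof.
have [/quotient_at_zero //|Np] := eqVneq (N p) 0.
have [c ac dp] := atlas_cover p.
pose V := chart_cod c `&` chart_inv c @^-1` (N @^-1` [set y | y != 0]).
have oV : open V.
  apply: open_chart_inv; rewrite -[_ @^-1` _]setTI; apply: open_preimage_on.
  - exact: openT.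
  - exact: open_neq.
  - by move=> q _; exact: smooth_continuous.
have VN x : V x -> N (chart_inv c x) != 0 by case.
exists c, V, (fun x => (uf \o chart_inv c) x * ((N \o chart_inv c) x)^-1); split.
  split=> //; last by move=> x [].
  by split; [exact: chart_map_cod|rewrite /= chart_mapK].
split=> [k|x Vx]; last by rewrite /= divfK // VN.
have sub : V `<=` chart_cod c by move=> x [].
apply: Ck_mul => //; first by apply: Ck_sub (s_uf ac k).
by apply: Ck_inv => //; apply: Ck_sub (sN ac k).
Qed.

(** The values at p of the continuous solutions s of uf = s N near p.  There is
    exactly one, so that [ratio] is defined without a case distinction on N p,
    and independently of charts. *)
Definition quotient_germ p : set R := [set l | exists s : M -> R,
  [/\ {for p, continuous s}, \forall q \near p, uf q = s q * N q & s p = l]].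

Definition ratio p : R := xget 0 (quotient_germ p).

Lemma quotient_germ_unique p l l' : quotient_germ p l -> quotient_germ p l' -> l = l'.
Proof.
move=> [s [cs ns <-]] [s' [cs' ns' <-]]; apply: contrapT => /eqP.
rewrite -subr_eq0 => ss; apply: (@zeros_nowhere_dense p).
have c : {for p, continuous (fun q => s q - s' q)} by exact: continuousB.
have nn : \forall q \near p, s q - s' q != 0.
  exact: (c [set y | y != 0] (open_nbhs_nbhs (conj (@open_neq R 0) ss))).
apply: (@filterS3 _ (nbhs p) _ _ _ _ _ _ ns ns' nn) => q e1 e2 h.
by apply: (mulfI h); rewrite mulr0 mulrBl -e1 -e2 subrr.
Qed.

Lemma ratio_germ p l : quotient_germ p l -> ratio p = l.
Proof. by move=> h; apply: xget_unique => // l' h'; exact: quotient_germ_unique h' h. Qed.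

Lemma ratio_smooth_eq : smooth ratio /\ forall p, uf p = ratio p * N p.
Proof.
have loc p c (V : set 'rV[R]_n) (sigma : 'rV[R]_n -> R) q : chart_dom c p -> open V -> V `<=` chart_cod c ->
    smooth_on V sigma ->
    (forall x, V x -> uf (chart_inv c x) = sigma x * N (chart_inv c x)) ->
    chart_dom c q -> V (chart_map c q) -> ratio q = sigma (chart_map c q).
  move=> dp oV VO ssig E dq Vq; apply: ratio_germ.
  exists (sigma \o chart_map c); split=> //.
    apply: (@continuous_comp _ _ _ (chart_map c) sigma).
      exact: chart_map_continuous.
    exact: Ck_continuous (ssig 0%N) Vq.
  have nV : \forall x \near chart_map c q, V x by exact: open_nbhs_nbhs.
  have := near_chart_map dq nV; apply: filterS => q' [dq' Vq'] /=.
  by have := E _ Vq'; rewrite chart_mapK.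
split=> [|p].
  apply: smooth_local => p; have [c [V [sigma [[ac dp oV Vp VO] [ssig E]]]]] := quotient_local p.
  exists c, V; split=> // k; apply: Ck_ext (ssig k) => // x /set_mem Vx /=.
  have cx := VO _ Vx; have dx := chart_inv_dom cx.
  by rewrite (loc p c V sigma) // chart_invK.
have [c [V [sigma [[ac dp oV Vp VO] [ssig E]]]]] := quotient_local p.
rewrite (loc p c V sigma) //; have := E _ Vp.
by rewrite chart_mapK.
Qed.

(** Where N is nonzero this is [differential_parallel] against u; at the zeros of
    u it follows by density, after extending w to a field. *)
Lemma differential_ratio (rho : M -> R) : smooth rho -> (forall p, uf p = rho p * N p) ->
  forall p w, tangent p w -> w f = rho p * g p (u p) w.
Proof.
move=> srho E p w tw; have [F _] := frame_exists p.
have [X sX <-] := tangent_extend F tw.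
apply/eqP; rewrite -subr_eq0; apply/eqP.
apply: (dense_eq0 (h := fun q => field_app X f q - rho q * inner g u X q)).
  apply: smoothB; first exact: field_app_smooth.
  by apply: smoothM => //; exact: inner_smooth.
move=> q Nq; apply: (mulIf Nq); rewrite mul0r mulrBl.
have := differential_parallel q sX su; rewrite -/N => ->.
rewrite -[u q f]/(uf q) E; have -> : inner g u X q = inner g X u q.
  by apply: metricC => //; exact: field_tangent.
by rewrite mulrAC subrr.
Qed.

Lemma gradient_ratio (rho : M -> R) : smooth rho -> (forall p, uf p = rho p * N p) ->
  gradient g f = field_scale rho u.
Proof.
move=> srho E; apply/funext => p; have tu := field_tangent p su.
have dE := differential_ratio srho E; have tru := tangent_scale (rho p) tu.
have good : tangent p (rho p *: u p) /\
    forall w, tangent p w -> g p (rho p *: u p) w = w f.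
  by split=> // w tw; rewrite metricZl // -dE.
apply: xget_unique => // v [tv gv]; apply/eqP; rewrite -subr_eq0; apply/eqP.
have tvu := tangent_sub tv tru.
by apply: (metric_eq0 hg tvu); rewrite metricBl // gv // good.2 // subrr.
Qed.

Lemma ratio_unique (rho rho' : M -> R) : smooth rho -> smooth rho' ->
  field_scale rho u = field_scale rho' u -> rho = rho'.
Proof.
move=> s1 s2 E; apply/funext => p; apply/eqP; rewrite -subr_eq0; apply/eqP.
apply: (dense_eq0 (h := fun q => rho q - rho' q)); first exact: smoothB.
move=> q Nq; apply: (mulIf Nq); rewrite mul0r mulrBl.
have tu := field_tangent q su.
have := congr1 (fun X : field M => g q (X q) (u q)) E.
rewrite /= /field_scale !(metricZl hg _ tu tu) => ->.
by rewrite subrr.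
Qed.

Lemma gradient_quotient : exists! rho : M -> R,
    smooth rho /\ gradient g f = field_scale rho u.
Proof.
have [sr E] := ratio_smooth_eq.
exists ratio; split; first by split=> //; exact: gradient_ratio.
move=> rho' [s' E']; apply: ratio_unique => //.
by rewrite -E' (gradient_ratio sr E).
Qed.

End Concircular.

Theorem theorem3p1 (R : realType) (n : nat) (hn : (1 < n)%N)
  (M : manifold R n) (hM : connected [set: M])
  (g : M -> functional M -> functional M -> R) (hg : riemannian_metric g)
  (nabla : field M -> field M -> field M) (hnabla : levi_civita g nabla)
  (u : field M) (f : M -> R) (hu : concircular nabla u f)
  (hf : exists p : M, f p <> 0) :
  exists! rho : M -> R,
    smooth rho /\ gradient g f = field_scale rho u.
Proof. exact: (gradient_quotient hg hnabla hu hn hM hf). Qed.
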